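(* Let $K$ be a finite extension of $\mathbb{Q}$ and $f:\mathbb{N}\to K$ a multiplicative function. Suppose $F(z)=\sum_{n\geq 1}f(n)z^n\in K[[z]]$ is algebraic over $K(z)$. Then either $f(n)$ is eventually zero or there is a nonnegative integer $k$ and a periodic multiplicative function $\chi:\mathbb{N}\to K$ such that $f(n)=n^k\chi(n)$ for all $n\in\mathbb{N}$.
   Context: $\mathbb{N}=\{1,2,3,\ldots\}$. A function $f$ on $\mathbb{N}$ is multiplicative if $f(mn)=f(m)f(n)$ whenever $\gcd(m,n)=1$. A function $\chi$ is periodic if there is $d\in\mathbb{N}$ with $\chi(n+d)=\chi(n)$ for all $n$. *)

(* Defs.v *)
From HB Require Import structures.
From mathcomp Require Import all_boot all_order all_algebra all_field.
From mathcomp Require Import boolp.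

Set Implicit Arguments.
Unset Strict Implicit.
Unset Printing Implicit Defensive.

Import GRing.Theory.
Local Open Scope ring_scope.

Section ArithmeticFunctions.
Variable K : fieldType.

(* Arithmetic functions have domain {1, 2, 3, ...}; they are represented by    *)
(* functions on nat whose value at 0 is irrelevant.                            *)
Definition multiplicative_fun (f : nat -> K) : Prop :=
  forall m n : nat, (0 < m)%N -> (0 < n)%N -> coprime m n ->
    f (m * n)%N = f m * f n.

Definition periodic_fun (chi : nat -> K) : Prop :=
  exists2 d : nat, (0 < d)%N & forall n : nat, (0 < n)%N -> chi (n + d)%N = chi n.

Definition eventually_zero (f : nat -> K) : Prop :=
  exists N : nat, forall n : nat, (N <= n)%N -> f n = 0.

End ArithmeticFunctions.

(* The ring K[[z]]: [Fps a] is the series \sum_n (a n) z^n.                     *)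
Record fps (K : fieldType) := Fps { fcoef : nat -> K }.

HB.instance Definition _ (K : fieldType) := gen_eqMixin (fps K).
HB.instance Definition _ (K : fieldType) := gen_choiceMixin (fps K).

Section PowerSeries.
Variable K : fieldType.
Implicit Types a b c : fps K.

Lemma fpsP a b : (forall n, fcoef a n = fcoef b n) -> a = b.
Proof. by case: a b => [a] [b] /= eq_ab; congr Fps; apply/funext. Qed.

Definition fps_zero : fps K := Fps (fun=> 0).
Definition fps_one : fps K := Fps (fun n => (n == 0%N)%:R).
Definition fps_opp a : fps K := Fps (fun n => - fcoef a n).
Definition fps_add a b : fps K := Fps (fun n => fcoef a n + fcoef b n).
Definition fps_mul a b : fps K :=
  Fps (fun n => \sum_(j < n.+1) fcoef a j * fcoef b (n - j)%N).

Fact fps_addA : associative fps_add.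
Proof. by move=> a b c; apply: fpsP => n /=; rewrite addrA. Qed.
Fact fps_addC : commutative fps_add.
Proof. by move=> a b; apply: fpsP => n /=; rewrite addrC. Qed.
Fact fps_add0 : left_id fps_zero fps_add.
Proof. by move=> a; apply: fpsP => n /=; rewrite add0r. Qed.
Fact fps_addN : left_inverse fps_zero fps_opp fps_add.
Proof. by move=> a; apply: fpsP => n /=; rewrite addNr. Qed.

HB.instance Definition _ :=
  GRing.isZmodule.Build (fps K) fps_addA fps_addC fps_add0 fps_addN.

Definition fps_trunc (m : nat) a : {poly K} := \poly_(i < m) fcoef a i.

Lemma fps_mul_trunc m n a b : (n < m)%N ->
  fcoef (fps_mul a b) n = (fps_trunc m a * fps_trunc m b)`_n.
Proof.
move=> lt_nm; rewrite coefM /=; apply: eq_bigr => j _.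
have le_jn : (j <= n)%N by rewrite -ltnS.
by rewrite !coef_poly (leq_ltn_trans le_jn) // (leq_ltn_trans (leq_subr _ _)).
Qed.

Fact fps_mulC : commutative fps_mul.
Proof.
by move=> a b; apply: fpsP => n; rewrite !(fps_mul_trunc _ _ (ltnSn n)) mulrC.
Qed.

Fact fps_mulA : associative fps_mul.
Proof.
move=> a b c; apply: fpsP => n; pose t := fps_trunc n.+1.
have eql : fcoef (fps_mul a (fps_mul b c)) n = (t a * (t b * t c))`_n.
  rewrite coefM /=; apply: eq_bigr => j _; have le_jn : (j <= n)%N by rewrite -ltnS.
  rewrite -(@fps_mul_trunc n.+1) ?ltnS ?leq_subr //.
  by rewrite /t coef_poly ltnS le_jn.
have eqr : fcoef (fps_mul (fps_mul a b) c) n = (t a * t b * t c)`_n.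
  rewrite coefM /=; apply: eq_bigr => j _.
  by rewrite -(@fps_mul_trunc n.+1) // /t coef_poly ltnS leq_subr.
by rewrite eql eqr mulrA.
Qed.

Fact fps_mul1 : left_id fps_one fps_mul.
Proof.
move=> a; apply: fpsP => n /=; rewrite big_ord_recl /= subn0 mul1r big1 ?addr0 //.
by move=> i _; rewrite mul0r.
Qed.

Fact fps_mulDl : left_distributive fps_mul fps_add.
Proof.
move=> a b c; apply: fpsP => n /=; rewrite -big_split /=.
by apply: eq_bigr => j _; rewrite mulrDl.
Qed.

Fact fps_one_neq0 : fps_one != 0.
Proof. by apply/eqP => /(congr1 (fun a => fcoef a 0)) /eqP; rewrite /= oner_eq0. Qed.

HB.instance Definition _ := GRing.Zmodule_isComNzRing.Build (fps K)
  fps_mulA fps_mulC fps_mul1 fps_mulDl fps_one_neq0.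

Definition fps_unit : pred (fps K) := fun a => `[< exists b, b * a = 1 >].
Definition fps_inv a : fps K :=
  if pselect (exists b, b * a = 1) is left ex_b then projT1 (cid ex_b) else a.

Fact fps_mulV : {in fps_unit, left_inverse 1 fps_inv *%R}.
Proof.
move=> a /asboolP ua; rewrite /fps_inv; case: pselect => // ex_b.
exact: projT2 (cid ex_b).
Qed.
Fact fps_unitPl a b : b * a = 1 -> fps_unit a.
Proof. by move=> ba1; apply/asboolP; exists b. Qed.
Fact fps_inv_out : {in [predC fps_unit], fps_inv =1 id}.
Proof.
move=> a /negP nua; rewrite /fps_inv; case: pselect => // ex_b.
by case: nua; apply/asboolP.
Qed.

HB.instance Definition _ := GRing.ComNzRing_hasMulInverse.Build (fps K)
  fps_mulV fps_unitPl fps_inv_out.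

Lemma fps_neq0_order a : a != 0 ->
  exists2 i, fcoef a i != 0 & forall j, (j < i)%N -> fcoef a j = 0.
Proof.
move=> nz_a; have ex_i : exists i, fcoef a i != 0.
  apply: contrapT => no_i; case/eqP: nz_a; apply: fpsP => n /=.
  by apply: contrapT => /eqP nz; apply: no_i; exists n.
case: (ex_minnP ex_i) => i nz_ai min_i; exists i => // j lt_ji.
by apply: contraTeq lt_ji => /min_i; rewrite -leqNgt.
Qed.

Fact fps_mulf_eq0 : GRing.integral_domain_axiom (fps K).
Proof.
move=> a b ab0; apply: contrapT => /negP; rewrite negb_or => /andP[].
move=> /fps_neq0_order[i nz_ai lt_i] /fps_neq0_order[j nz_bj lt_j].
have /eqP := congr1 (fun c => fcoef c (i + j)%N) ab0.
have lt_iij : (i < (i + j).+1)%N by rewrite ltnS leq_addr.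
rewrite /= (bigD1 (Ordinal lt_iij)) //= addKn big1 ?addr0 => [|k ne_ki].
  by rewrite mulf_eq0 (negPf nz_ai) (negPf nz_bj).
case: (ltngtP k i) => [/lt_i->|lt_ik|eq_ki]; first by rewrite mul0r.
  rewrite [fcoef b _]lt_j ?mulr0 // ltn_subLR ?ltn_add2r // -ltnS.
  exact: ltn_ord.
by case/eqP: ne_ki; apply: val_inj.
Qed.

HB.instance Definition _ := GRing.ComUnitRing_isIntegral.Build (fps K)
  fps_mulf_eq0.

Definition fps_of_poly (p : {poly K}) : fps K := Fps (fun n => p`_n).

Fact fps_of_poly_is_zmod_morphism : zmod_morphism fps_of_poly.
Proof. by move=> p q; apply: fpsP => n /=; rewrite coefB. Qed.
HB.instance Definition _ := GRing.isZmodMorphism.Build {poly K} (fps K)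
  fps_of_poly fps_of_poly_is_zmod_morphism.
Fact fps_of_poly_is_monoid_morphism : monoid_morphism fps_of_poly.
Proof.
by split=> [|p q]; apply: fpsP => n /=; rewrite ?coef1 // coefM.
Qed.
HB.instance Definition _ := GRing.isMonoidMorphism.Build {poly K} (fps K)
  fps_of_poly fps_of_poly_is_monoid_morphism.

Lemma fps_of_poly_inj : injective fps_of_poly.
Proof.
by move=> p q pq; apply/polyP => n; exact: (congr1 (fun a => fcoef a n) pq).
Qed.

End PowerSeries.

Notation ratfun K := {fraction {poly K}}.

(* The field K((z)), as the field of fractions of K[[z]].                      *)
Notation laurent K := {fraction (fps K)}.

Section RationalFunctions.
Variable K : fieldType.

Local Notation "x %:F" := (FracField.tofrac x).

(* The embedding of K(z) in K((z)) extending that of K[z] in K[[z]].           *)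
Definition laurent_of_ratfun (u : ratfun K) : laurent K :=
  (fps_of_poly \n_(repr u))%:F / (fps_of_poly \d_(repr u))%:F.

Lemma ratfunE (u : ratfun K) : u = (\n_(repr u))%:F / (\d_(repr u))%:F.
Proof.
rewrite -[LHS]reprK; move: (repr u) => x; unlock FracField.tofrac.
rewrite -[X in _ = _ * X]FracField.pi_inv -[RHS]FracField.pi_mul.
rewrite /FracField.mulf /FracField.invf.
by rewrite !numden_Ratio ?oner_eq0 ?denom_ratioP // mulr1 mul1r Ratio_numden.
Qed.

Lemma fps_of_poly_frac_eq0 (p : {poly K}) :
  ((fps_of_poly p)%:F == 0 :> laurent K) = (p == 0).
Proof. by rewrite tofrac_eq0 -(inj_eq (@fps_of_poly_inj K)) rmorph0. Qed.

Lemma laurent_of_ratfun_frac (p q : {poly K}) : q != 0 ->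
  laurent_of_ratfun (p%:F / q%:F) = (fps_of_poly p)%:F / (fps_of_poly q)%:F.
Proof.
move=> nz_q; rewrite /laurent_of_ratfun; set u : ratfun K := p%:F / q%:F.
have nz_d : \d_(repr u) != 0 by apply: denom_ratioP.
have /eqP := ratfunE u; rewrite {1}/u eqr_div ?tofrac_eq0 // -!tofracM tofrac_eq.
move=> /eqP eq_pq; apply/eqP; rewrite eqr_div ?fps_of_poly_frac_eq0 //.
by rewrite -!tofracM -!rmorphM eq_pq.
Qed.

Lemma laurent_of_ratfun_tofrac (p : {poly K}) :
  laurent_of_ratfun p%:F = (fps_of_poly p)%:F.
Proof.
rewrite -[p%:F]divr1 -tofrac1 laurent_of_ratfun_frac ?oner_eq0 //.
by rewrite rmorph1 tofrac1 divr1.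
Qed.

Fact laurent_of_ratfun_is_zmod_morphism : zmod_morphism laurent_of_ratfun.
Proof.
move=> u v; rewrite (ratfunE u) (ratfunE v).
move: (denom_ratioP (repr u)) (denom_ratioP (repr v)).
move: \n_(repr u) \d_(repr u) \n_(repr v) \d_(repr v) => p q r s nz_q nz_s.
rewrite -mulNr addf_div ?tofrac_eq0 // -tofracN -!tofracM -tofracD.
rewrite !laurent_of_ratfun_frac ?mulf_neq0 // -mulNr addf_div ?fps_of_poly_frac_eq0 //.
by rewrite -tofracN -!tofracM -tofracD !(rmorphD, rmorphM, rmorphN).
Qed.
HB.instance Definition _ := GRing.isZmodMorphism.Build (ratfun K) (laurent K)
  laurent_of_ratfun laurent_of_ratfun_is_zmod_morphism.

Fact laurent_of_ratfun_is_monoid_morphism : monoid_morphism laurent_of_ratfun.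
Proof.
split=> [|u v]; first by rewrite -tofrac1 laurent_of_ratfun_tofrac rmorph1 tofrac1.
rewrite (ratfunE u) (ratfunE v).
move: (denom_ratioP (repr u)) (denom_ratioP (repr v)).
move: \n_(repr u) \d_(repr u) \n_(repr v) \d_(repr v) => p q r s nz_q nz_s.
rewrite mulf_div -!tofracM !laurent_of_ratfun_frac ?mulf_neq0 //.
by rewrite mulf_div -!tofracM -!rmorphM.
Qed.
HB.instance Definition _ := GRing.isMonoidMorphism.Build (ratfun K) (laurent K)
  laurent_of_ratfun laurent_of_ratfun_is_monoid_morphism.

(* Algebraicity over K(z), in the extension field K((z)) of K(z) and K[[z]].     *)
Definition fps_algebraic (F : fps K) : Prop :=
  algebraicOver laurent_of_ratfun F%:F.

(* The series \sum_(n >= 1) f(n) z^n, with no constant term.                   *)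
Definition gen_fps (f : nat -> K) : fps K :=
  Fps (fun n => if n == 0%N then 0 else f n).

End RationalFunctions.

(* Main.v *)
From HB Require Import structures.
Require Import Defs.
From mathcomp Require Import all_boot all_order all_algebra all_field.
From mathcomp Require Import cyclic boolp zify ring.

(** An algebraic series is differentially finite, so [f] satisfies a recurrence with
polynomial coefficients. If [f] vanishes at powers of infinitely many primes, the Chinese
remainder theorem produces arbitrarily late windows of zeros, and [f] is eventually zero.
Otherwise, for a large prime [l], the sequence [f (l * n) - f l * f n] is supported on the
multiples of [l] and satisfies a recurrence of order less than [l], hence it is zero: [f] is
completely multiplicative, and nonzero, on the integers prime to some [Q].

Then [G a = f (Q * a + 1)] satisfies [G (M * a + 1) = G 1 * G a] with [M = Q + 1]. Let [A_n]
be the matrix over [K(x)] that takes a window of [G] at [a] to the window at [a + n].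
Dilation shows that [A_(M n) (M x + 1)] is conjugate, by a fixed rational matrix, to [A_n (x)],
so the degrees of [A_n] grow only logarithmically in [n]. Since the poles of [A_n] are
translates of finitely many points, all poles away from the two ends of the window must
cancel; counting dimensions then gives a polynomial [P] such that [P * G] satisfies a linear
recurrence with constant coefficients. Dilation also shows that the [M]-th power map permutes
its characteristic roots, which are therefore roots of unity, and [f] is a rational
function on some progression [1 + Q' N]; by multiplicativity it is [n ^ k] there, with [k] an
integer. The sparse-support argument shows that [f n / n ^ k] is periodic. Finally [k < 0]
is impossible, as [sum chi n / n * z ^ n] is transcendental: an algebraic antiderivative
of a rational function is rational. *)

Set Implicit Arguments.
Unset Strict Implicit.
Unset Printing Implicit Defensive.

Import GRing.Theory.
Local Open Scope ring_scope.

(** * Sequences over the field of rational functions *)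

Definition evt (P : nat -> Prop) := exists N, forall n, (N <= n)%N -> P n.

Lemma evt_imp (P Q : nat -> Prop) : (forall n, P n -> Q n) -> evt P -> evt Q.
Proof. by move=> PQ [N HP]; exists N => n /HP/PQ. Qed.

Lemma evt_imp2 (P Q S : nat -> Prop) :
  (forall n, P n -> Q n -> S n) -> evt P -> evt Q -> evt S.
Proof.
move=> PQS [N HP] [N' HQ]; exists (maxn N N') => n; rewrite geq_max => /andP[le1 le2].
by apply: PQS; [apply: HP | apply: HQ].
Qed.

Lemma evt_affine (P : nat -> Prop) (q b : nat) :
  (0 < q)%N -> evt P -> evt (fun n => P (q * n + b)%N).
Proof. by move=> q0 [N HP]; exists N => n leNn; apply: HP; nia. Qed.

Lemma evt_shift (P : nat -> Prop) (b : nat) : evt P -> evt (fun n => P (n + b)%N).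
Proof. by move=> [N HP]; exists N => n leNn; apply: HP; lia. Qed.

Lemma evt_fin (T : finType) (P : T -> nat -> Prop) :
  (forall i, evt (P i)) -> evt (fun n => forall i, P i n).
Proof.
move=> /choice[N HN]; exists (\max_i N i) => n le_n i; apply: HN.
exact: leq_trans (leq_bigmax i) le_n.
Qed.

Lemma evt_unshift (P : nat -> Prop) (b : nat) : evt (fun n => P (n + b)%N) -> evt P.
Proof.
move=> [N HP]; exists (N + b)%N => n le_n.
by rewrite -(subnK (_ : b <= n)%N); [apply: HP|]; lia.
Qed.

Lemma sum_coef_widen (C : nzRingType) (w : {poly C}) (N : nat) (X : nat -> C) :
  (size w <= N)%N -> \sum_(k < N) w`_k * X k = \sum_(k < size w) w`_k * X k.
Proof.
move=> le_w; rewrite [RHS](big_ord_widen N (fun k => w`_k * X k)) // [RHS]big_mkcond.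
apply: eq_bigr => k _; case: ltnP => // le_k; by rewrite nth_default ?mul0r.
Qed.

(** An appended zero column makes [A] square with determinant zero. Working over a domain yields
    polynomial kernel vectors when [R] is [{poly C}]. *)
Lemma kernel_row (R : idomainType) (s : nat) (A : 'M[R]_(s.+1, s)) :
  exists2 v : 'rV[R]_s.+1, v != 0 & v *m A = 0.
Proof.
pose B : 'M[R]_s.+1 :=
  \matrix_(i, j) if unlift ord_max j is Some k then A i k else 0.
have /det0P[v nz_v vB] : \det B == 0.
  rewrite (expand_det_col _ ord_max) big1 // => i _.
  by rewrite mxE unlift_none mul0r.
exists v => //; apply/rowP => k; have := congr1 (fun u : 'rV_ _ => u 0 (lift ord_max k)) vB.
rewrite /= mxE [RHS]mxE => e; rewrite mxE [RHS]mxE -[RHS]e.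
by apply: eq_bigr => i _; rewrite [B _ _]mxE liftK.
Qed.

Section Sequences.
Variable C : fieldType.
Hypothesis char0 : [pchar C] =i pred0.
Implicit Types (p q : {poly C}) (g h : nat -> C).

Lemma natf_eq0 (n : nat) : (n%:R == 0 :> C) = (n == 0)%N.
Proof. by move/pcharf0P: char0. Qed.

Lemma natf_inj : injective (fun n : nat => n%:R : C).
Proof.
move=> m n; wlog le_mn : m n / (m <= n)%N => [hw /= eq_mn|/=].
  case/orP: (leq_total m n) => le; first exact: hw.
  by apply/esym/hw.
move=> eq_mn; have : (n - m)%:R == 0 :> C by rewrite natrB // eq_mn subrr.
by rewrite natf_eq0; lia.
Qed.

Lemma poly_evt p : p != 0 -> evt (fun n => p.[n%:R] != 0).
Proof.
move=> nz_p; apply: contrapT => nev.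
have inf N : exists2 n, (N <= n)%N & root p n%:R.
  apply: contrapT => noN; apply: nev; exists N => n le_n; apply/negP => rt.
  by apply: noN; exists n.
have ex k : exists s : seq nat, [/\ size s = k, uniq s & all (fun n => root p n%:R) s].
  elim: k => [|k [s [ss us rs]]]; first by exists [::].
  have [n le_n rn] := inf (\max_(i <- s) i).+1.
  exists (n :: s); split=> /=; rewrite ?ss ?us ?rs ?rn ?andbT //.
  apply/negP => n_s; have := @leq_bigmax_seq _ s xpredT id n n_s isT; rewrite /=; lia.
have [s [ss us rs]] := ex (size p).
have := @max_poly_roots _ p [seq n%:R | n <- s] nz_p.
rewrite size_map ss ltnn all_map => H; suff: false by [].
by apply: H; rewrite // map_inj_uniq //; exact: natf_inj.
Qed.

Lemma poly_evt0 p : evt (fun n => p.[n%:R] = 0) -> p = 0.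
Proof.
move=> ev; apply/eqP; apply: contrapT => /negP nz_p.
have [N HN] := evt_imp2 (fun n => @conj _ _) ev (poly_evt nz_p).
by have [-> /eqP] := HN N (leqnn N).
Qed.

Definition affp (a b : nat) : {poly C} := a%:R *: 'X + b%:R%:P.

Lemma size_affp a b : (0 < a)%N -> size (affp a b) = 2.
Proof.
by case: a => // a _; rewrite /affp -mul_polyC size_MXaddC polyC_eq0 size_polyC natf_eq0.
Qed.

Lemma horner_affp p a b (n : nat) : (p \Po affp a b).[n%:R] = p.[(a * n + b)%:R].
Proof. by rewrite horner_comp !hornerE natrD natrM. Qed.

Lemma affp_neq0 p a b : (0 < a)%N -> (p \Po affp a b != 0) = (p != 0).
Proof. by move=> a0; rewrite -!size_poly_gt0 size_comp_poly2 // size_affp. Qed.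

(** Membership in the span of the [g i] over [C(x)], up to finitely many terms. The denominator [D]
    stays on the left, so its roots cause no division by zero. *)
Definition ratspan (s : nat) (g : 'I_s -> nat -> C) (h : nat -> C) :=
  exists2 D : {poly C}, D != 0 & exists t : 'I_s -> {poly C},
    evt (fun n => D.[n%:R] * h n = \sum_i (t i).[n%:R] * g i n).

Section Span.
Variables (s : nat) (g : 'I_s -> nat -> C).

Lemma ratspan_gen i : ratspan g (g i).
Proof.
exists 1; rewrite ?oner_eq0 //; exists (fun j => (j == i)%:R); exists 0%N => n _.
rewrite (bigD1 i) //= eqxx big1 ?addr0 ?hornerE // => j /negPf->.
by rewrite horner0 mul0r.
Qed.

Lemma ratspanD h1 h2 : ratspan g h1 -> ratspan g h2 -> ratspan g (fun n => h1 n + h2 n).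
Proof.
move=> [D1 nz1 [t1 ev1]] [D2 nz2 [t2 ev2]].
exists (D1 * D2); first by rewrite mulf_neq0.
exists (fun i => D2 * t1 i + D1 * t2 i).
apply: evt_imp2 ev1 ev2 => n e1 e2.
rewrite hornerM mulrDr -mulrA mulrCA e1 -mulrA e2 !mulr_sumr -big_split /=.
by apply: eq_bigr => i _; rewrite hornerD !hornerM mulrDl !mulrA.
Qed.

Lemma ratspanM p h : ratspan g h -> ratspan g (fun n => p.[n%:R] * h n).
Proof.
move=> [D nz [t ev]]; exists D => //; exists (fun i => p * t i).
apply: evt_imp ev => n e; rewrite mulrCA e mulr_sumr.
by apply: eq_bigr => i _; rewrite hornerM mulrA.
Qed.

Lemma ratspan0 : ratspan g (fun=> 0).
Proof.
exists 1; rewrite ?oner_eq0 //; exists (fun=> 0); exists 0%N => n _.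
by rewrite mulr0 big1 // => i _; rewrite horner0 mul0r.
Qed.

Lemma ratspan_ext h h' : h =1 h' -> ratspan g h' -> ratspan g h.
Proof. by move/funext->. Qed.

Lemma ratspan_sum (m : nat) (h : nat -> nat -> C) :
  (forall i, (i < m)%N -> ratspan g (h i)) -> ratspan g (fun n => \sum_(i < m) h i n).
Proof.
elim: m => [|m IH] sp.
  by apply: ratspan_ext ratspan0 => n; rewrite big_ord0.
apply: (@ratspan_ext _ (fun n => \sum_(i < m) h i n + h m n)) => [n|].
  by rewrite big_ord_recr.
by apply: ratspanD; [apply: IH => i im; apply: sp; lia | apply: sp].
Qed.

Lemma ratspan_div p h h' : p != 0 -> evt (fun n => p.[n%:R] * h n = h' n) ->
  ratspan g h' -> ratspan g h.
Proof.
move=> nz_p ev [D nz [t ev']]; exists (p * D); rewrite ?mulf_neq0 //.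
exists t; apply: evt_imp2 ev ev' => n e <-.
by rewrite hornerM -e mulrCA mulrA.
Qed.

(** Once denominators are cleared, the [s.+1] coordinate rows of length [s] over [C[x]] have a
    nontrivial relation. Recurrences of controlled order come from this count. *)
Lemma ratspan_dep (h : nat -> nat -> C) :
  (forall k, (k <= s)%N -> ratspan g (h k)) ->
  exists2 c : nat -> {poly C}, exists2 k, (k <= s)%N & c k != 0 &
    evt (fun n => \sum_(k < s.+1) (c k).[n%:R] * h k n = 0).
Proof.
move=> sp; have /choice[D HD] (k : 'I_s.+1) : exists D : {poly C}, D != 0 /\
    exists t : 'I_s -> {poly C},
      evt (fun n => D.[n%:R] * h k n = \sum_i (t i).[n%:R] * g i n).
  by have [D ? ?] := sp k (ltn_ord k); exists D.
have /choice[t Ht] (k : 'I_s.+1) := (HD k).2.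
have [v nz_v vA] := kernel_row (\matrix_(k, i) t k i).
exists (fun k => v 0 (inord k) * D (inord k)).
  have /rV0Pn[k nz_k] := nz_v; exists k; first by rewrite -ltnS.
  by rewrite inord_val mulf_neq0 // (HD k).1.
apply: evt_imp (evt_fin Ht) => n Hn.
transitivity (\sum_k \sum_i (v 0 k * t k i).[n%:R] * g i n).
  apply: eq_bigr => k _; rewrite inord_val hornerM -mulrA Hn mulr_sumr.
  by apply: eq_bigr => i _; rewrite hornerM mulrA.
rewrite exchange_big big1 //= => i _; rewrite -mulr_suml -horner_sum.
have := congr1 (fun u : 'rV_ _ => u 0 i) vA; rewrite /= mxE [RHS]mxE => e0.
rewrite (_ : \sum_k _ = 0) ?horner0 ?mul0r // -[RHS]e0.
by apply: eq_bigr => k _; rewrite [in RHS]mxE.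
Qed.

End Span.

(* The coefficients are indexed by nat; only those of index at most r matter. *)
Definition precursive (r : nat) (f : nat -> C) :=
  exists2 p : nat -> {poly C}, exists2 i, (i <= r)%N & p i != 0 &
    evt (fun n => \sum_(i < r.+1) (p i).[n%:R] * f (n + i)%N = 0).

(** Zero top coefficients are dropped, possibly down to order 0, so that the recurrence can be
    solved for its last term. *)
Lemma precursive_lead r f : precursive r f ->
  exists r' (p : nat -> {poly C}), [/\ (r' <= r)%N, p r' != 0 &
    evt (fun n => \sum_(i < r'.+1) (p i).[n%:R] * f (n + i)%N = 0)].
Proof.
elim: r => [|r IH] [p [i le_i nz_i] ev].
  by exists 0%N, p; split=> //; move: nz_i; rewrite (_ : i = 0%N) //; lia.
case: (eqVneq (p r.+1) 0) => [p0|nz]; last by exists r.+1, p.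
have [|r' [p' [le_r nz ev']]] := IH.
  exists p; first (exists i => //).
    by rewrite leqNgt; apply: contra nz_i => lt; rewrite (_ : i = r.+1) ?p0 //; lia.
  by apply: evt_imp ev => n; rewrite big_ord_recr /= p0 horner0 mul0r addr0.
by exists r', p'; split=> //; lia.
Qed.

Lemma precursive_leW r r' f : (r <= r')%N -> precursive r f -> precursive r' f.
Proof.
move=> le_r [p [i le_i nz] ev]; exists (fun i => if (i <= r)%N then p i else 0).
  by exists i; rewrite ?le_i //; lia.
apply: evt_imp ev => n e; rewrite -[RHS]e (big_ord_widen r'.+1 (fun i => (p i).[n%:R] * f (n + i)%N)) //.
rewrite [RHS]big_mkcond; apply: eq_bigr => j _ /=.
by rewrite ltnS; case: ifP => // _; rewrite horner0 mul0r.
Qed.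

(** Strong induction on [j]: the recurrence translated by [j - r] expresses [f (n + j)] through
    earlier shifts. *)
Lemma precursive_ratspan r f (p : nat -> {poly C}) : p r != 0 ->
  evt (fun n => \sum_(i < r.+1) (p i).[n%:R] * f (n + i)%N = 0) ->
  forall j, ratspan (fun (i : 'I_r) n => f (n + i)%N) (fun n => f (n + j)%N).
Proof.
move=> nz ev j; elim/ltn_ind: j => j IH.
case: (ltnP j r) => [lt_j|le_j]; first exact: (ratspan_gen _ (Ordinal lt_j)).
pose k := (j - r)%N; have ej : j = (k + r)%N by rewrite /k; lia.
apply: (@ratspan_div _ _ (p r \Po affp 1 k) _
   (fun n => \sum_(i < r) (- (p i \Po affp 1 k)).[n%:R] * f (n + (k + i))%N)).
- by rewrite affp_neq0.
- apply: evt_imp (evt_shift k ev) => n; rewrite big_ord_recr /= => /eqP.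
  rewrite addrC addr_eq0 => /eqP e; rewrite horner_affp mul1n ej addnA e -sumrN.
  by apply: eq_bigr => i _; rewrite hornerN horner_affp mul1n mulNr addnA.
apply: (ratspan_sum (h := fun i n => (- (p i \Po affp 1 k)).[n%:R] * f (n + (k + i))%N)).
by move=> i lt_i; apply: ratspanM; apply: IH; lia.
Qed.

Lemma ratspan_affine s (g : 'I_s -> nat -> C) h a b : (0 < a)%N -> ratspan g h ->
  ratspan (fun i n => g i (a * n + b)%N) (fun n => h (a * n + b)%N).
Proof.
move=> a0 [D nz [t ev]]; exists (D \Po affp a b); rewrite ?affp_neq0 //.
exists (fun i => t i \Po affp a b); apply: evt_imp (evt_affine b a0 ev) => n /= e.
by rewrite horner_affp e; apply: eq_bigr => i _; rewrite horner_affp.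
Qed.

(** The terms [f (a * (n + k) + b)] are shifts of [f] at the argument [a * n + b], all in one span
    of at most [r] sequences; hence the order does not grow. *)
Lemma precursive_section r f a b : (0 < a)%N -> precursive r f ->
  precursive r (fun n => f (a * n + b)%N).
Proof.
move=> a0 /precursive_lead[r' [p [le_r nz ev]]]; apply: (precursive_leW le_r).
have sp := precursive_ratspan nz ev.
have := @ratspan_dep r' (fun i n => f (a * n + b + i)%N)
  (fun k n => f (a * (n + k) + b)%N); case=> [k _|c ex ev'].
  apply: (ratspan_ext _ (ratspan_affine b a0 (sp (a * k)%N))) => n.
  by congr f; lia.
by exists c.
Qed.

End Sequences.

(** * Polynomial matrices and shifts *)

Section PolyMatrices.
Variable C : fieldType.
Hypothesis char0 : [pchar C] =i pred0.
Implicit Types (p q : {poly C}).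

Definition iaffp (a b : nat) : {poly C} := a%:R^-1 *: ('X - b%:R%:P).

Lemma affpK a b : (0 < a)%N -> affp C a b \Po iaffp a b = 'X.
Proof.
move=> a0; rewrite /affp /iaffp comp_polyD comp_polyZ comp_polyX comp_polyC.
by rewrite scalerA mulfV ?scale1r ?subrK // (natf_eq0 char0) -lt0n.
Qed.

Lemma comp_affpK p a b : (0 < a)%N -> (p \Po affp C a b) \Po iaffp a b = p.
Proof. by move=> a0; rewrite -comp_polyA affpK // comp_polyXr. Qed.

Lemma iaffpK a b : (0 < a)%N -> iaffp a b \Po affp C a b = 'X.
Proof.
move=> a0; rewrite /affp /iaffp comp_polyZ comp_polyB comp_polyX comp_polyC addrK.
by rewrite scalerA mulVf ?scale1r // (natf_eq0 char0) -lt0n.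
Qed.

Lemma comp_iaffpK p a b : (0 < a)%N -> (p \Po iaffp a b) \Po affp C a b = p.
Proof. by move=> a0; rewrite -comp_polyA iaffpK // comp_polyXr. Qed.

Definition shiftp (n : nat) p : {poly C} := p \Po affp C 1 n.
HB.instance Definition _ n := GRing.RMorphism.copy (shiftp n) (comp_poly (affp C 1 n)).

Lemma horner_shiftp n p x : (shiftp n p).[x] = p.[x + n%:R].
Proof. by rewrite /shiftp horner_comp !hornerE. Qed.

Lemma shiftp_nat n p (a : nat) : (shiftp n p).[a%:R] = p.[(a + n)%:R].
Proof. by rewrite horner_shiftp natrD. Qed.

Lemma shiftpD n k p : shiftp n (shiftp k p) = shiftp (n + k) p.
Proof.
rewrite /shiftp -comp_polyA; congr (_ \Po _); rewrite /affp !scale1r comp_polyD.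
by rewrite comp_polyX comp_polyC -addrA -polyCD -natrD.
Qed.

Lemma shiftp0 p : shiftp 0 p = p.
Proof. by rewrite /shiftp /affp scale1r addr0 comp_polyXr. Qed.

Lemma size_shiftp n p : size (shiftp n p) = size p.
Proof. by rewrite size_comp_poly2 // size_affp. Qed.

Lemma shiftp_eq0 n p : (shiftp n p == 0) = (p == 0).
Proof. by rewrite -!size_poly_eq0 size_shiftp. Qed.

Definition size_le_mx (k l h : nat) (A : 'M[{poly C}]_(k, l)) :=
  forall i j, (size (A i j) <= h.+1)%N.

Lemma size_le_mxW k l h h' (A : 'M[{poly C}]_(k, l)) : (h <= h')%N -> size_le_mx h A -> size_le_mx h' A.
Proof. by move=> le_h sA i j; apply: leq_trans (sA i j) _. Qed.

Lemma size_mulW p q h k : (size p <= h.+1)%N -> (size q <= k.+1)%N ->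
  (size (p * q)%R <= (h + k).+1)%N.
Proof. by move=> sp sq; apply: leq_trans (size_polyMleq _ _) _; lia. Qed.

Lemma size_le_mx_mul k l r h h' (A : 'M[{poly C}]_(k, l)) (B : 'M[{poly C}]_(l, r)) :
  size_le_mx h A -> size_le_mx h' B -> size_le_mx (h + h') (A *m B).
Proof.
move=> sA sB i j; rewrite mxE; apply: leq_trans (size_sum _ _ _) _.
by apply/bigmax_leqP => t _; apply: size_mulW.
Qed.

Lemma size_le_mx_scale k l h h' p (A : 'M[{poly C}]_(k, l)) :
  (size p <= h.+1)%N -> size_le_mx h' A -> size_le_mx (h + h') (p *: A).
Proof. by move=> sp sA i j; rewrite mxE size_mulW. Qed.

Lemma size_le_mx_shift k l h n (A : 'M[{poly C}]_(k, l)) : size_le_mx h A -> size_le_mx h (map_mx (shiftp n) A).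
Proof. by move=> sA i j; rewrite mxE size_shiftp. Qed.

Lemma size_le_mx_exists k l (A : 'M[{poly C}]_(k, l)) : exists h, size_le_mx h A.
Proof.
exists (\max_i \max_j size (A i j))%N => i j; apply: leqW.
exact: leq_trans (leq_bigmax (F := fun j => size (A i j)) j)
  (leq_bigmax (F := fun i => \max_j size (A i j)) i).
Qed.

Lemma scalemx_polyI k l p (A B : 'M[{poly C}]_(k, l)) :
  p != 0 -> p *: A = p *: B -> A = B.
Proof.
move=> nz_p /matrixP e; apply/matrixP => i j; have := e i j; rewrite !mxE.
exact: mulfI.
Qed.

End PolyMatrices.

(** * Common roots of shifted polynomials *)

Section CoprimeShifts.
Variable C : closedFieldType.
Hypothesis char0 : [pchar C] =i pred0.
Implicit Types (p q : {poly C}).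

(** A common root [x] of [p] and [shiftp i q] makes [i] the difference of a root [x + i] of [q] and
    the root [x] of [p]. [B] lists all such differences, with multiplicity. *)
Lemma bad_shifts p q : p != 0 -> q != 0 -> exists B : seq C,
  size B = ((size p).-1 * (size q).-1)%N /\
  forall i : nat, i%:R \notin B -> coprimep p (shiftp i q).
Proof.
move=> nz_p nz_q; have [rp ep] := closed_field_poly_normal p.
have [rq eq] := closed_field_poly_normal q.
have size_r (u : {poly C}) r : u != 0 -> u = lead_coef u *: \prod_(z <- r) ('X - z%:P) ->
    size r = (size u).-1.
  by move=> nz_u ->; rewrite size_scale ?lead_coef_eq0 // size_prod_XsubC.
have root_r (u : {poly C}) r x : u != 0 -> u = lead_coef u *: \prod_(z <- r) ('X - z%:P) ->
    root u x = (x \in r).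
  by move=> nz_u ->; rewrite rootZ ?lead_coef_eq0 // root_prod_XsubC.
exists [seq y - x | x <- rp, y <- rq]; rewrite size_allpairs (size_r p rp) // (size_r q rq) //.
split=> // i nbad; apply: Pdiv.ClosedField.root_coprimep => x rx.
apply: contra nbad; rewrite horner_shiftp => ry.
apply/allpairsP; exists (x, x + i%:R) => /=; rewrite -(root_r p rp) // -(root_r q rq) //.
by split=> //; rewrite addrAC subrr add0r.
Qed.

(** Two roots of [q] differ by only finitely many integers, and [s] is taken beyond all of them. *)
Lemma dispersion q : q != 0 -> exists s : nat, forall i j : nat,
  (i + s <= j)%N -> forall x, (shiftp i q).[x] = 0 -> (shiftp j q).[x] != 0.
Proof.
move=> nz_q; have [B [_ HB]] := bad_shifts nz_q nz_q.
have [|s Hs] := @poly_evt C char0 (\prod_(b <- B) ('X - b%:P)).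
  by apply/monic_neq0/monic_prod_XsubC.
exists s => i j le_ij x; rewrite !horner_shiftp => qx.
have /coprimep_root/(_ (introT eqP qx)) : coprimep q (shiftp (j - i) q).
  apply: HB; have := Hs (j - i)%N; rewrite -rootE root_prod_XsubC; apply; lia.
by rewrite horner_shiftp -addrA -natrD subnKC //; lia.
Qed.

End CoprimeShifts.

Lemma exp_gt_linear (M a b : nat) : (1 < M)%N -> exists j, (a * j + b < M ^ j)%N.
Proof.
move=> M1; have step k : (k < M ^ k)%N by exact: ltn_expl.
have sq k : (k * k < M ^ (2 * k))%N.
  by rewrite mul2n -addnn expnD; have := step k; nia.
(* With [k = 2 * a + b + 1] and [j = 2 * k], one has [a * j + b < k * k < M ^ j]. *)
by exists (2 * (2 * a + b + 1))%N; have := sq (2 * a + b + 1)%N; nia.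
Qed.

(** * Heights of transition matrices *)

Section Transition.
Variable C : fieldType.
Hypothesis char0 : [pchar C] =i pred0.
Variables (d : nat) (G : nat -> C) (q : nat -> {poly C}).
Hypothesis lead_neq0 : q d.+1 != 0.
Hypothesis recG : evt (fun n => \sum_(i < d.+2) (q i).[n%:R] * G (n + i)%N = 0).
Hypothesis indepG : forall c : nat -> {poly C},
  evt (fun n => \sum_(i < d.+1) (c i).[n%:R] * G (n + i)%N = 0) ->
  forall i, (i <= d)%N -> c i = 0.
Notation qd := (q d.+1).
Notation mxp := 'M[{poly C}]_d.+1.

Definition window (a : nat) : 'cV[C]_d.+1 := \col_i G (a + i)%N.

Definition eval_mx k l (a : nat) (A : 'M[{poly C}]_(k, l)) : 'M[C]_(k, l) :=
  map_mx (horner_eval a%:R) A.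

Lemma eval_mxM k l r a (A : 'M[{poly C}]_(k, l)) (B : 'M[{poly C}]_(l, r)) :
  eval_mx a (A *m B) = eval_mx a A *m eval_mx a B.
Proof. exact: map_mxM. Qed.

Lemma eval_mxZ k l a p (A : 'M[{poly C}]_(k, l)) : eval_mx a (p *: A) = p.[a%:R] *: eval_mx a A.
Proof. exact: map_mxZ. Qed.

Lemma eval_mx_shift k l a n (A : 'M[{poly C}]_(k, l)) : eval_mx a (map_mx (shiftp n) A) = eval_mx (a + n) A.
Proof. by apply/matrixP => i j; rewrite !mxE; exact: shiftp_nat. Qed.

(** Minimality of the order in matrix form: identities between polynomial matrices may be tested on
    late windows. *)
Lemma indepM k (A : 'M[{poly C}]_(k, d.+1)) :
  evt (fun a => eval_mx a A *m window a = 0) -> A = 0.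
Proof.
move=> ev; apply/matrixP => i j.
have := @indepG (fun t => A i (inord t)) _ j; rewrite inord_val mxE; apply.
  apply: evt_imp ev => a /matrixP/(_ i 0); rewrite mxE [RHS]mxE => e.
  by rewrite -[RHS]e; apply: eq_bigr => t _; rewrite inord_val !mxE.
by rewrite -ltnS.
Qed.

(** The companion matrix of the recurrence, multiplied by the leading coefficient to stay
    polynomial. *)
Definition companion_mx : mxp :=
  \matrix_(i, j) if (i < d)%N then (j == i.+1 :> nat)%:R * qd else - q j.

Lemma companion_step : evt (fun a => qd.[a%:R] *: window a.+1 = eval_mx a companion_mx *m window a).
Proof.
apply: evt_imp recG => a; rewrite big_ord_recr /= => /eqP; rewrite addrC addr_eq0 => /eqP e.
apply/colP => i; rewrite !mxE; case: (ltnP i d) => [lt_i|le_i].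
  have lt_i1 : (i.+1 < d.+1)%N by [].
  rewrite (bigD1 (Ordinal lt_i1)) //= big1 ?addr0 => [|j ne_j].
    by rewrite !mxE lt_i /= eqxx mul1r /horner_eval addnS addSn.
  rewrite !mxE lt_i (_ : (j == i.+1 :> nat) = false); last by apply/negbTE; rewrite -val_eqE in ne_j.
  by rewrite mul0r /horner_eval horner0 mul0r.
have -> : (i : nat) = d by have := ltn_ord i; lia.
rewrite addSnnS e -sumrN; apply: eq_bigr => j _.
by rewrite !mxE ltnNge le_i /= /horner_eval hornerN mulNr.
Qed.

(** A left kernel vector [v (x)] would annihilate the window at [a + 1] when evaluated at [a]; in
    the variable of that window it is [v (x - 1)], which independence forces to vanish. *)
Lemma det_companion_neq0 : \det companion_mx != 0.
Proof.
apply/negP => /det0P[v /negP nz_v vC]; apply: nz_v.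
have e : map_mx (comp_poly (iaffp C 1 1)) v = 0.
  apply: indepM; have [N HN] := evt_imp2 (fun a => @conj _ _) companion_step (poly_evt char0 lead_neq0).
  exists N.+1 => -[//|a]; rewrite ltnS => /HN[e nz].
  have -> : eval_mx a.+1 (map_mx (comp_poly (iaffp C 1 1)) v) = eval_mx a v.
    apply/matrixP => i j; rewrite !mxE /horner_eval horner_comp !hornerE.
    by rewrite invr1 mul1r -natrB ?subn1.
  apply: (scalerI nz); rewrite scaler0 scalemxAr e mulmxA -eval_mxM vC.
  by rewrite /eval_mx map_mx0 mul0mx.
apply/eqP; have := congr1 (map_mx (comp_poly (affp C 1 1))) e; rewrite map_mx0 => <-.
by apply/matrixP => i j; rewrite !mxE comp_iaffpK.
Qed.

Definition lead_prod (n : nat) : {poly C} := \prod_(0 <= i < n) shiftp i qd.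

Fixpoint transition_mx (n : nat) : mxp :=
  if n is k.+1 then map_mx (shiftp k) companion_mx *m transition_mx k else 1%:M.

Lemma lead_prod_neq0 n : lead_prod n != 0.
Proof. by rewrite prodf_seq_neq0; apply/allP => i _; rewrite shiftp_eq0. Qed.

Lemma transition_step n : evt (fun a => (lead_prod n).[a%:R] *: window (a + n) = eval_mx a (transition_mx n) *m window a).
Proof.
elim: n => [|n IH].
  exists 0%N => a _; rewrite /lead_prod big_nil hornerE scale1r addn0 /=.
  by rewrite /eval_mx map_mx1 mul1mx.
apply: evt_imp2 IH (evt_shift n companion_step) => a e1 e2.
rewrite /lead_prod big_nat_recr //= -/(lead_prod n) hornerM shiftp_nat -scalerA addnS e2.
by rewrite scalemxAr e1 eval_mxM eval_mx_shift mulmxA.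
Qed.

Lemma lead_prodD n k : lead_prod (n + k) = lead_prod n * shiftp n (lead_prod k).
Proof.
rewrite /lead_prod (@big_cat_nat _ _ _ n) ?leq_addr //=; congr (_ * _).
rewrite rmorph_prod -{1}[n]add0n big_addn addKn.
by apply: eq_bigr => i _; rewrite /= shiftpD addnC.
Qed.

Lemma transition_mxD n k : transition_mx (n + k) = map_mx (shiftp n) (transition_mx k) *m transition_mx n.
Proof.
elim: k => [|k IH]; first by rewrite addn0 /= map_mx1 mul1mx.
rewrite addnS /= IH map_mxM mulmxA; congr (_ *m _ *m _).
by apply/matrixP => i j; rewrite !mxE /= shiftpD.
Qed.

Lemma det_transition_mx n : \det (transition_mx n) = \prod_(0 <= i < n) shiftp i (\det companion_mx).
Proof.
elim: n => [|n IH]; first by rewrite big_nil det1.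
by rewrite big_nat_recr //= det_mulmx IH mulrC -det_map_mx.
Qed.

(* The rational matrix [transition_mx n / lead_prod n], which maps the window at [a] to the
   window at [a + n], equals [W / D] with degrees at most [h]. *)
Definition height_le (n h : nat) := exists D : {poly C}, exists W : mxp,
  [/\ D != 0, (size D <= h.+1)%N, size_le_mx h W & D *: transition_mx n = lead_prod n *: W].

Lemma height_leW n h h' : (h <= h')%N -> height_le n h -> height_le n h'.
Proof.
by move=> le_h [D [W [? sD sW e]]]; exists D, W; split=> //; [lia|exact: size_le_mxW sW].
Qed.

Lemma height_le0 : height_le 0 0.
Proof.
exists 1, 1%:M; split; rewrite ?oner_eq0 ?size_poly1 //; last by rewrite /lead_prod big_nil.
by move=> i j; rewrite mxE; case: eqP; rewrite ?size_poly1 ?size_poly0.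
Qed.

(** One more step multiplies by a shifted companion matrix, whose degree does not depend on [n]. *)
Lemma height_le_succ : exists c, forall n h, height_le n h -> height_le n.+1 (h + c).
Proof.
have [c sC] := size_le_mx_exists companion_mx; exists (size qd + c)%N => n h [D [W [nzD sD sW e]]].
exists (D * shiftp n qd), (map_mx (shiftp n) companion_mx *m W); split.
- by rewrite mulf_neq0 // shiftp_eq0.
- apply: leq_trans (_ : (h + size qd).+1 <= _)%N; last by lia.
  by apply: size_mulW => //; rewrite size_shiftp.
- by apply: size_le_mxW (size_le_mx_mul (size_le_mx_shift char0 n sC) sW); lia.
rewrite /= /lead_prod big_nat_recr //= -/(lead_prod n) [D * _]mulrC [lead_prod n * _]mulrC -!scalerA.
by rewrite !scalemxAr e.
Qed.

(** * Heights under the dilation x -> M x + m *)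

Section Dilation.
Variables (M m : nat) (gam : C).
Hypotheses (M_gt1 : (1 < M)%N) (gam_neq0 : gam != 0).
Hypothesis secG : forall a, G (M * a + m) = gam * G a.
Let M_gt0 : (0 < M)%N. Proof. exact: ltnW. Qed.

Definition dilate (p : {poly C}) : {poly C} := p \Po affp C M m.
HB.instance Definition _ := GRing.RMorphism.copy dilate (comp_poly (affp C M m)).

Lemma eval_mx_dilate k l a (A : 'M[{poly C}]_(k, l)) : eval_mx a (map_mx dilate A) = eval_mx (M * a + m) A.
Proof. by apply/matrixP => i j; rewrite !mxE; exact: horner_affp. Qed.

Lemma dilate_neq0 p : (dilate p != 0) = (p != 0).
Proof. exact: affp_neq0. Qed.

Lemma dilate_nat p (a : nat) : (dilate p).[a%:R] = p.[(M * a + m)%:R].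
Proof. exact: horner_affp. Qed.

(** The window at [a] is, up to [gam], made of the values of [G] at [M * a + m + M * k], each a
    rational combination of the window at [M * a + m]. [T] collects these combinations over the
    common denominator [e]. *)
Lemma dilation_mx : exists e (T : mxp), [/\ e != 0, \det T != 0 &
  evt (fun a => (e.[a%:R] * gam) *: window a = eval_mx a T *m window (M * a + m))].
Proof.
pose e := \prod_(k < d.+1) lead_prod (M * k).
pose T : mxp := \matrix_(k, j) ((\prod_(i < d.+1 | i != k) lead_prod (M * i)) * transition_mx (M * k) 0 j).
have nz_e : e != 0 by apply/prodf_neq0 => k _; exact: lead_prod_neq0.
have evT : evt (fun a => e.[a%:R] *: (\col_k G (a + M * k)%N : 'cV_d.+1) = eval_mx a T *m window a).
  have := evt_fin (fun k : 'I_d.+1 => transition_step (M * k)); apply: evt_imp => a Ha.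
  apply/colP => k; have /colP/(_ 0) := Ha k; rewrite !mxE addn0 => ek.
  rewrite /e (bigD1 k) //= hornerM mulrAC ek mulrC mulr_sumr.
  by apply: eq_bigr => j _; rewrite !mxE /horner_eval hornerM mulrA.
have evD : evt (fun a => ((dilate e).[a%:R] * gam) *: window a = eval_mx a (map_mx dilate T) *m window (M * a + m)).
  apply: evt_imp (evt_affine m M_gt0 evT) => a ea.
  rewrite eval_mx_dilate -ea dilate_nat; apply/colP => k; rewrite !mxE -mulrA -secG.
  by congr (_ * G _); lia.
exists (dilate e), (map_mx dilate T); split=> //; first by rewrite dilate_neq0.
apply/negP => /det0P[v /negP nz_v vT]; apply: nz_v; apply/eqP/indepM.
apply: evt_imp2 evD (poly_evt char0 (_ : dilate e != 0)); last by rewrite dilate_neq0.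
move=> a ea nz; apply: (scalerI (mulf_neq0 nz gam_neq0)); rewrite scaler0 scalemxAr ea.
by rewrite mulmxA -eval_mxM vT /eval_mx map_mx0 mul0mx.
Qed.

(** The transition by [M * n] steps, read at [M * x + m], is conjugate through [T] and its shift to
    the transition by [n] steps. Conjugation costs a bounded degree and the affine substitution
    costs none. *)
Lemma height_le_dilate : exists c, forall n h, height_le n h -> height_le (M * n) (h + c).
Proof.
have [e [T [nz_e nz_T evT]]] := dilation_mx.
(* Late windows at [M * a + m] also separate polynomial matrices: [\adj T] reduces this to windows
   at [a]. *)
have indepD k (A : 'M[{poly C}]_(k, d.+1)) :
    evt (fun a => eval_mx a A *m window (M * a + m) = 0) -> A = 0.
  move=> ev; apply: (scalemx_polyI nz_T); rewrite scaler0.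
  rewrite -mul_mx_scalar -mul_adj_mx mulmxA (_ : A *m \adj T = 0) ?mul0mx //.
  apply: indepM; apply: evt_imp2 (evt_imp2 (fun a => @conj _ _) ev evT)
    (evt_imp2 (fun a => @conj _ _) (poly_evt char0 nz_e) (poly_evt char0 nz_T)).
  move=> a [eA eT] [nz nz'].
  apply: (scalerI (mulf_neq0 nz gam_neq0)); rewrite scaler0 scalemxAr eT mulmxA -eval_mxM.
  by rewrite -mulmxA mul_adj_mx mul_mx_scalar eval_mxZ -scalemxAl eA scaler0.
(* Two routes from the window at [M * a + m] to the one at [a + n]: jump then contract, or contract
   then jump. *)
have star n : (e * lead_prod n) *: (map_mx (shiftp n) T *m map_mx dilate (transition_mx (M * n)))
    = (dilate (lead_prod (M * n)) * shiftp n e) *: (transition_mx n *m T).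
  apply/eqP; rewrite -subr_eq0; apply/eqP; apply: indepD.
  apply: evt_imp2 (evt_imp2 (fun a => @conj _ _) evT (evt_shift n evT))
    (evt_imp2 (fun a => @conj _ _) (transition_step n) (evt_affine m M_gt0 (transition_step (M * n)))).
  move=> a [e1 e2] [e3 e4]; rewrite /eval_mx map_mxB -!/(eval_mx _ _) mulmxBl; apply/eqP.
  rewrite subr_eq0 !eval_mxZ !eval_mxM eval_mx_shift eval_mx_dilate -!scalemxAl -!mulmxA -e1 -e4.
  have -> : (M * a + m + M * n = M * (a + n) + m)%N by lia.
  rewrite -!scalemxAr -e2 -e3 !scalerA !hornerM dilate_nat shiftp_nat; apply/eqP.
  by congr (_ *: _); ring.
have [cT sT] := size_le_mx_exists T; have [cA sA] := size_le_mx_exists (\adj T).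
exists (size e + (size e + (size (\det T) + (cT + cA))))%N => n h [D [W [nzD sD sW eW]]].
pose u := map_mx (comp_poly (iaffp C M m)) : mxp -> mxp.
have szu k (A : mxp) : size_le_mx k A -> size_le_mx k (u A).
  move=> sz i j; rewrite mxE; apply: leq_trans (sz i j).
  by rewrite -(size_comp_poly2 (_ \Po _) (size_affp char0 m M_gt0)) comp_iaffpK.
exists ((D * e * shiftp n (\det T)) \Po iaffp C M m).
exists (u (shiftp n e *: (map_mx (shiftp n) (\adj T) *m W *m T))); split.
- rewrite -(affp_neq0 char0 _ m M_gt0) comp_iaffpK //.
  by rewrite !mulf_neq0 // shiftp_eq0.
- rewrite -(size_comp_poly2 (_ \Po _) (size_affp char0 m M_gt0)) comp_iaffpK //.
  apply: leq_trans (_ : (h + size e + size (\det T)).+1 <= _)%N; last by lia.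
  by apply: size_mulW; [apply: size_mulW | rewrite size_shiftp].
- apply: szu.
  have s1 := size_le_mx_mul (size_le_mx_mul (size_le_mx_shift char0 n sA) sW) sT.
  have se : (size (shiftp n e) <= (size e).+1)%N by rewrite size_shiftp.
  by apply: size_le_mxW (size_le_mx_scale se s1); lia.
have eD : (D * e * shiftp n (\det T)) *: map_mx dilate (transition_mx (M * n))
    = dilate (lead_prod (M * n)) *: (shiftp n e *: (map_mx (shiftp n) (\adj T) *m W *m T)).
  apply: (scalemx_polyI (lead_prod_neq0 n)).
  have hA : map_mx (shiftp n) (\adj T) *m (map_mx (shiftp n) T *m map_mx dilate (transition_mx (M * n)))
      = shiftp n (\det T) *: map_mx dilate (transition_mx (M * n)).
    by rewrite mulmxA -map_mxM mul_adj_mx map_scalar_mx mul_scalar_mx.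
  transitivity (D *: ((e * lead_prod n) *: (shiftp n (\det T) *: map_mx dilate (transition_mx (M * n))))).
    by rewrite !scalerA; congr (_ *: _); ring.
  rewrite -hA scalemxAr star scalemxAr [D *: (_ *: _)]scalerA [D * _]mulrC.
  rewrite -[_ *: (transition_mx n *m T)]scalerA scalemxAl eW.
  by rewrite -scalemxAl !scalerA -scalemxAr mulmxA; congr (_ *: _); ring.
have := congr1 u eD; rewrite /u [LHS]map_mxZ [RHS]map_mxZ /= comp_affpK //.
rewrite (_ : map_mx _ (map_mx dilate _) = transition_mx (M * n)) //.
by apply/matrixP => i j; rewrite !mxE comp_affpK.
Qed.

(** Write [n] in base [M]: each digit costs one dilation and fewer than [M] single steps. *)
Lemma height_le_log : exists c, forall j n, (n < M ^ j)%N -> height_le n (c * j).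
Proof.
have [c1 H1] := height_le_succ; have [c2 H2] := height_le_dilate; exists (c2 + M * c1)%N.
elim=> [|j IH] n lt_n; first by move: lt_n; rewrite expn0 ltnS leqn0 muln0 => /eqP->; exact: height_le0.
have lt_n' : (n %/ M < M ^ j)%N by rewrite ltn_divLR // -expnSr.
have step r k h : height_le k h -> height_le (k + r) (h + r * c1).
  elim: r k h => [|r IHr] k h Hk; first by rewrite addn0 mul0n addn0.
  by rewrite addnS; apply: height_leW (H1 _ _ (IHr _ _ Hk)); lia.
rewrite (divn_eq n M) mulnC; apply: height_leW (step _ _ _ (H2 _ _ (IH _ lt_n'))).
by have := ltn_pmod n M_gt0; nia.
Qed.

End Dilation.
End Transition.

(** * Cancellation of the central poles *)

Section Poles.
Variable C : closedFieldType.
Hypothesis char0 : [pchar C] =i pred0.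
Variables (d : nat) (q : nat -> {poly C}).
Hypothesis lead_neq0 : q d.+1 != 0.
Hypothesis det_neq0 : \det (companion_mx d q) != 0.
Variables (M c : nat).
Hypothesis M_gt1 : (1 < M)%N.
Hypothesis height_le_log : forall j n, (n < M ^ j)%N -> height_le d q n (c * j).
Notation Tr := (transition_mx d q).
Notation Lp := (lead_prod d q).
Notation qd := (q d.+1).
Notation qt := (qd * \det (companion_mx d q)).

(** Pigeonhole: [K.+1] disjoint blocks of length [L] cannot all contain one of the at most [K] bad
    shifts. *)
Lemma free_block (D : {poly C}) (L K : nat) : D != 0 ->
  ((size D).-1 * (size qt).-1 <= K)%N -> exists2 k, (k <= K)%N &
  forall i, (k * L <= i < k.+1 * L)%N -> coprimep D (shiftp i qt).
Proof.
move=> nzD leK; have nz_qt : qt != 0 by rewrite mulf_neq0.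
have [B [sB HB]] := bad_shifts nzD nz_qt; apply: contrapT => no.
have /choice[b Hb] (k : 'I_K.+1) : exists i, (k * L <= i < k.+1 * L)%N /\ i%:R \in B.
  apply: contrapT => nok; apply: no; exists k; first by rewrite -ltnS.
  by move=> i ik; apply: HB; apply/negP => iB; apply: nok; exists i.
have: (size [seq (b k)%:R : C | k <- enum 'I_K.+1] <= size B)%N.
  apply: uniq_leq_size => [|x /mapP[k _ ->]]; last by have [] := Hb k.
  rewrite map_inj_in_uniq ?enum_uniq // => k k' _ _ /(natf_inj char0) e.
  have [+ _] := Hb k; have [+ _] := Hb k'; rewrite e => /andP[a1 a2] /andP[a3 a4].
  apply: val_inj => /=; have : (k * L < k'.+1 * L)%N by lia.
  have : (k' * L < k.+1 * L)%N by lia.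
  by rewrite !ltn_mul2r => /andP[_ ?] /andP[_ ?]; lia.
by rewrite size_map size_enum_ord sB; lia.
Qed.

(** A transition of length [L] is embedded in a far longer one whose reduced denominator [D] has too
    small a degree to meet every block of length [L]. In a block avoiding [D], a central pole of the
    middle factor could cancel only against poles or zeros of the outer factors, which dispersion
    keeps away. *)
Lemma central_dvd : exists s : nat, forall L i j,
  (\prod_(s <= k < L - s) shiftp k qd) %| Tr L i j.
Proof.
have nz_qt : qt != 0 by rewrite mulf_neq0.
have [s Hs] := dispersion char0 nz_qt; exists s => L i j.
case: (posnP L) => [->|L0]; first by rewrite sub0n big_geq // dvd1p.
have qd_qt k x : (shiftp k qd).[x] = 0 -> (shiftp k qt).[x] = 0.
  by move=> e; rewrite rmorphM /= hornerM e mul0r.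
have det_qt k x : (shiftp k (\det (companion_mx d q))).[x] = 0 -> (shiftp k qt).[x] = 0.
  by move=> e; rewrite rmorphM /= hornerM e mulr0.
(* The number of blocks grows linearly in [t], the admissible length [M ^ t] exponentially. *)
have [t Ht] := @exp_gt_linear M (c * (size qt).-1 * L) L M_gt1.
pose K := (c * t * (size qt).-1)%N; pose n := (K.+1 * L)%N.
have [|D [W [nzD sD _ eW]]] := @height_le_log t n; first move: Ht.
  rewrite /n /K; move: (size qt).-1 => z.
  by rewrite mulSn (_ : c * t * z * L = c * z * L * t)%N; [lia|ring].
have [|k le_k Hk] := @free_block D L K nzD; first by rewrite /K leq_mul //; case: (size D) sD.
pose a := (k * L)%N; pose r := (n - (a + L))%N.
have en : n = ((a + L) + r)%N by rewrite /r /a /n; nia.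
pose E2 := \prod_(s <= k < L - s) shiftp k qd.
have dvdE : E2 %| Lp L.
  rewrite /lead_prod; case: (leqP (s + s) L) => le_s; last by rewrite /E2 big_geq ?dvd1p //; lia.
  rewrite (@big_cat_nat _ _ _ s) //=; last by lia.
  rewrite [X in _ * X](@big_cat_nat _ _ _ (L - s)) //=; try lia.
  exact: dvdp_mull (dvdp_mulr _ (dvdpp _)).
pose X := map_mx (shiftp (a + L)) (Tr r).
have ePI : Tr n = X *m (map_mx (shiftp a) (Tr L) *m Tr a) by rewrite en transition_mxD transition_mxD.
have shdet b e : shiftp b (\det (Tr e)) = \prod_(0 <= i < e) shiftp (b + i) (\det (companion_mx d q)).
  by rewrite det_transition_mx rmorph_prod; apply: eq_bigr => ? _; rewrite /= shiftpD.
(* The middle factor is isolated by multiplying with the adjugates of the outer ones. *)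
have eL : (D * \det X * \det (Tr a)) * shiftp a (Tr L i j)
    = Lp n * (\adj X *m W *m \adj (Tr a)) i j.
  have := congr1 (fun A => (\adj X *m A *m \adj (Tr a)) i j) eW.
  rewrite ePI /= -!scalemxAr -!scalemxAl mxE [RHS]mxE => <-.
  rewrite !mulmxA mul_adj_mx mul_scalar_mx -!scalemxAl -mulmxA mul_mx_adj mul_mx_scalar.
  by rewrite !mxE /= -!mulrA; congr (_ * (_ * _)); rewrite mulrC.
(* [D] is avoided by the choice of block; the determinants of the outer factors vanish only at
   shifts at least [s] away from those in [E2]. *)
have cop : coprimep (shiftp a E2) (D * \det X * \det (Tr a)).
  apply: Pdiv.ClosedField.root_coprimep => x; rewrite /E2 rmorph_prod /=.
  rewrite rootE horner_prod big_seq prodf_seq_eq0 => /hasP[u]; rewrite mem_index_iota => us.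
  rewrite us /= shiftpD => /eqP/qd_qt qu; rewrite !hornerM !mulf_neq0 //.
  - apply/negP => Dx; have /coprimep_root/(_ Dx) : coprimep D (shiftp (a + u) qt).
      by apply: Hk; rewrite /a; nia.
    by rewrite qu eqxx.
  - rewrite /X det_map_mx /= shdet horner_prod prodf_seq_neq0.
    apply/allP => v; rewrite mem_index_iota => /andP[_ lt_v]; apply/implyP => _.
    by apply/eqP => /det_qt e; have := Hs (a + u)%N (a + L + v)%N _ x qu; rewrite e eqxx; lia.
  - have -> : Tr a = map_mx (shiftp 0) (Tr a).
      by apply/matrixP => ? ?; rewrite mxE /= shiftp0.
    rewrite det_map_mx /= shdet horner_prod prodf_seq_neq0.
    apply/allP => v; rewrite mem_index_iota => /andP[_ lt_v]; apply/implyP => _.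
    by apply/eqP => /det_qt e; have := Hs _ (a + u)%N _ x e; rewrite qu eqxx; lia.
have : shiftp a E2 %| shiftp a (Tr L i j).
  rewrite -(Gauss_dvdpr _ cop) eL; apply: dvdp_mulr.
  rewrite en -addnA lead_prodD; apply: dvdp_mull; rewrite lead_prodD rmorphM; apply: dvdp_mulr.
  by have /dvdpP[w ->] := dvdE; rewrite rmorphM; exact: dvdp_mulIr.
move=> /dvdpP[w ew]; apply/dvdpP; exists (w \Po iaffp C 1 a).
by have := congr1 (comp_poly (iaffp C 1 a)) ew; rewrite /= comp_polyM !comp_affpK.
Qed.

(** After division by the central factor [E], only the denominators of the two ends, of length [s],
    remain; the logarithmic height then bounds the degree of the numerator [V]. *)
Lemma small_transition : exists s : nat, forall t L, (s + s <= L)%N -> (L < M ^ t)%N ->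
  exists E (V : 'M[{poly C}]_d.+1), [/\ E != 0, Tr L = E *: V,
    Lp L = Lp s * E * shiftp (L - s) (Lp s) & size_le_mx (size (Lp s) + size (Lp s) + c * t) V].
Proof.
have [s Hs] := central_dvd; exists s => t L le_L lt_L.
pose E := \prod_(s <= k < L - s) shiftp k qd.
have nzE : E != 0 by rewrite prodf_seq_neq0; apply/allP => k _; rewrite shiftp_eq0.
have eE : Lp L = Lp s * E * shiftp (L - s) (Lp s).
  have le_s : (s <= L - s)%N by lia.
  have -> : Lp L = Lp (L - s) * shiftp (L - s) (Lp s) by rewrite -lead_prodD subnK //; lia.
  by congr (_ * _); rewrite /lead_prod (@big_cat_nat _ _ _ s).
pose V : 'M_d.+1 := \matrix_(i, j) (Tr L i j %/ E).
have eV : Tr L = E *: V.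
  by apply/matrixP => i j; rewrite !mxE mulrC divpK //; exact: Hs.
exists E, V; split=> // i j.
have [D [W [nzD sD sW eW]]] := height_le_log lt_L.
have e : D * V i j = Lp s * shiftp (L - s) (Lp s) * W i j.
  apply: (mulfI nzE); have /matrixP/(_ i j) := eW; rewrite eV eE !mxE => eij.
  by rewrite mulrCA eij; ring.
have [->|nzV] := eqVneq (V i j) 0; first by rewrite size_poly0.
have : (size (V i j) <= size (D * V i j)%R)%N.
  by rewrite size_mul //; move: nzD; rewrite -size_poly_gt0; case: (size D) => // k _; rewrite leq_addl.
move/leq_trans; apply; rewrite e; apply: size_mulW => //.
by apply: size_mulW; rewrite ?size_shiftp.
Qed.

End Poles.

Lemma kernel_row_rect (C : fieldType) (k l : nat) (A : 'M[C]_(k, l)) : (l < k)%N ->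
  exists2 v : 'rV[C]_k, v != 0 & v *m A = 0.
Proof.
move=> lt_lk; have : kermx A != 0.
  rewrite kermx_eq0 /row_free; have := rank_leq_col A; lia.
move=> nz; exists (nz_row (kermx A)); first by rewrite nz_row_eq0.
by apply/sub_kermxP; exact: nz_row_sub.
Qed.

(** For a recurrence of minimal order, the first rows of many transitions, cleared of the end
    denominators, have logarithmic degree. There are more of them than the dimension of the space
    they lie in, so constants suffice to relate them. *)
Theorem self_similar_precursive (C : closedFieldType) (char0 : [pchar C] =i pred0)
    (G : nat -> C) (r M m : nat) (gam : C) :
  precursive r G -> ~ evt (fun n => G n = 0) ->
  (1 < M)%N -> gam != 0 -> (forall a, G (M * a + m)%N = gam * G a) ->
  exists2 P : {poly C}, P != 0 &
  exists2 w : {poly C}, w != 0 &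
    evt (fun n => \sum_(k < size w) w`_k * (P.[(n + k)%:R] * G (n + k)%N) = 0).
Proof.
move=> pG nG M1 nz_gam secG.
have exr : exists r, `[< precursive r G >] by exists r; apply/asboolP.
case: (ex_minnP exr) => d0 /asboolP pd mind.
have [d' [q [le_d nzq recG]]] := precursive_lead pd.
have ed : d' = d0.
  apply/eqP; rewrite eqn_leq le_d; apply: mind; apply/asboolP.
  by exists q => //; exists d'.
subst d'; case: d0 => [|d] in pd mind nzq recG le_d *.
  (* A recurrence of order 0 says that a nonzero polynomial times [G] is eventually zero. *)
  case: nG; apply: evt_imp2 recG (poly_evt char0 nzq) => n; rewrite big_ord1 addn0.
  by move=> /eqP; rewrite mulf_eq0 => /orP[/eqP->|/eqP//]; rewrite eqxx.
have indepG (u : nat -> {poly C}) :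
    evt (fun n => \sum_(i < d.+1) (u i).[n%:R] * G (n + i)%N = 0) ->
    forall i, (i <= d)%N -> u i = 0.
  move=> ev i le_i; apply/eqP; apply: contrapT => /negP nzu.
  have : (d.+1 <= d)%N by apply: mind; apply/asboolP; exists u => //; exists i.
  by rewrite ltnn.
have nz_det := det_companion_neq0 char0 nzq recG indepG.
have [c Hc] := height_le_log char0 nzq recG indepG M1 nz_gam secG.
have [s Hs] := small_transition char0 nzq nz_det M1 Hc.
pose b0 := (size (lead_prod d q s) + size (lead_prod d q s)).+1.
(* [t] makes the number [N] of rows exceed [d.+1 * b], the number of coefficients in one row. *)
have [t Ht] := @exp_gt_linear M (d.+1 * c) (d.+1 * b0 + s + s) M1.
pose b := (b0 + c * t)%N; pose N := (M ^ t - (s + s))%N.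
have ltN : (d.+1 * b < N)%N by rewrite /N /b; nia.
have /choice[EV HEV] (k : 'I_N) : exists EV : {poly C} * 'M[{poly C}]_d.+1,
    [/\ EV.1 != 0, transition_mx d q (s + s + k) = EV.1 *: EV.2,
    lead_prod d q (s + s + k) = lead_prod d q s * EV.1 * shiftp (s + k) (lead_prod d q s) & size_le_mx b.-1 EV.2].
  have [||E [V [? ? e ?]]] := Hs t (s + s + k)%N; first by lia.
    by have := ltn_ord k; rewrite /N; lia.
  by exists (E, V); split=> //; rewrite e; congr (_ * shiftp _ _); lia.
have [v nzv vA] := kernel_row_rect
  (\matrix_(k < N) mxvec (\matrix_(i < d.+1, u < b) ((EV k).2 0 i)`_u)) ltN.
have vV i : \sum_k (v 0 k)%:P * (EV k).2 0 i = 0.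
  apply/polyP => u; rewrite coef0 coef_sum; case: (ltnP u b) => [lt_u|le_u]; last first.
    rewrite big1 // => k _; rewrite coefCM nth_default ?mulr0 //.
    by have [_ _ _ sz] := HEV k; apply: leq_trans (sz 0 i) _; rewrite prednK.
  have := congr1 (fun A : 'rV_ _ => A 0 (mxvec_index i (Ordinal lt_u))) vA.
  rewrite /= mxE [RHS]mxE => e; rewrite -[RHS]e; apply: eq_bigr => k _.
  by rewrite coefCM !mxE mxvecE !mxE.
pose w := \poly_(k < N) (if insub k is Some k' then v 0 k' else 0).
have ew (k : 'I_N) : w`_k = v 0 k by rewrite coef_poly ltn_ord valK.
(* At [n + (s + s) + k] this polynomial equals [lead_prod d q s] at [n + (s + k)], the far end
   denominator; the near one depends on [n] alone and is cancelled. *)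
exists (lead_prod d q s \Po iaffp C 1 s).
  by rewrite -(affp_neq0 char0 _ s (ltn0Sn 0)) comp_iaffpK // lead_prod_neq0.
exists w.
  have /rV0Pn[k nzk] := nzv; apply: contra nzk => /eqP w0.
  by rewrite -ew w0 coef0.
apply: (@evt_unshift _ (s + s)).
have evk (k : 'I_N) : evt (fun n => (lead_prod d q s).[n%:R] * ((lead_prod d q s).[(n + (s + k))%:R] *
    G (n + (s + s + k))%N) = \sum_i ((EV k).2 0 i).[n%:R] * G (n + i)%N).
  have [nzE ePI eEn _] := HEV k.
  apply: evt_imp2 (transition_step nzq recG (s + s + k)) (poly_evt char0 nzE) => n e nz.
  apply: (mulfI nz); have := congr1 (fun A : 'cV_ _ => A 0 0) e.
  rewrite eEn ePI eval_mxZ -scalemxAl !mxE addn0 !hornerM shiftp_nat => e0.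
  rewrite (eq_bigr (fun i => eval_mx n (EV k).2 0 i * window d G n i 0)) => [|i _]; last by rewrite !mxE.
  by rewrite -e0; ring.
apply: evt_imp2 (evt_fin evk) (poly_evt char0 (lead_prod_neq0 char0 nzq s)) => n Hn nz.
rewrite -(@sum_coef_widen _ w N (fun k => (lead_prod d q s \Po iaffp C 1 s).[(n + (s + s) + k)%:R] *
  G (n + (s + s) + k)%N)) ?size_poly //; apply: (mulfI nz).
rewrite mulr0 mulr_sumr.
transitivity (\sum_k \sum_i ((v 0 k)%:P * (EV k).2 0 i).[n%:R] * G (n + i)%N).
  apply: eq_bigr => k _; rewrite ew mulrCA.
  have -> : (lead_prod d q s \Po iaffp C 1 s).[(n + (s + s) + k)%:R] = (lead_prod d q s).[(n + (s + k))%:R].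
    have -> : (n + (s + s) + k = 1 * (n + (s + k)) + s)%N by lia.
    by rewrite -horner_affp comp_iaffpK.
  rewrite -addnA Hn mulr_sumr; apply: eq_bigr => i _.
  by rewrite hornerM hornerC mulrA.
rewrite exchange_big big1 // => i _.
by rewrite -mulr_suml -horner_sum vV horner0 mul0r.
Qed.

(** * Constant-coefficient recurrences *)

Section Operators.
Variable C : fieldType.
Implicit Types (p q w : {poly C}) (u : nat -> C).

(** The polynomial [w] in the shift operator, so that products of polynomials act by composition. *)
Definition shift_op w u (n : nat) : C := \sum_(k < size w) w`_k * u (n + k)%N.

Lemma shift_opE N w u n : (size w <= N)%N -> shift_op w u n = \sum_(k < N) w`_k * u (n + k)%N.
Proof. by move=> le_N; rewrite (sum_coef_widen (fun k => u (n + k)%N)). Qed.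

Lemma shift_opD w1 w2 u n : shift_op (w1 + w2) u n = shift_op w1 u n + shift_op w2 u n.
Proof.
pose N := maxn (size w1) (size w2).
rewrite !(@shift_opE N) ?leq_maxl ?leq_maxr ?size_polyD // -big_split /=.
by apply: eq_bigr => k _; rewrite coefD mulrDl.
Qed.

Lemma shift_opC c w u n : shift_op (c%:P * w) u n = c * shift_op w u n.
Proof.
rewrite mul_polyC (shift_opE _ _ (size_scale_leq c w)) [in RHS](shift_opE _ _ (leqnn _)) mulr_sumr.
by apply: eq_bigr => k _; rewrite coefZ mulrA.
Qed.

Lemma shift_op0 u n : shift_op 0 u n = 0.
Proof. by rewrite /shift_op size_poly0 big_ord0. Qed.

Lemma shift_op1 u n : shift_op 1 u n = u n.
Proof. by rewrite /shift_op size_poly1 big_ord1 coef1 eqxx mul1r addn0. Qed.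

Lemma shift_opX w u n : shift_op (w * 'X) u n = shift_op w u n.+1.
Proof.
have le : (size (w * 'X)%R <= (size w).+1)%N.
  by apply: leq_trans (size_polyMleq _ _) _; rewrite size_polyX addn2.
rewrite (shift_opE _ _ le) big_ord_recl coefMX /= mul0r add0r.
by apply: eq_bigr => k _; rewrite coefMX /= /bump /= add1n addnS addSn.
Qed.

Lemma shift_opM p w u n : shift_op (p * w) u n = shift_op p (shift_op w u) n.
Proof.
elim/poly_ind: p n => [|p c IH] n; first by rewrite mul0r !shift_op0.
rewrite mulrDl !shift_opD mulrAC !shift_opX IH shift_opC -[c%:P]mulr1 shift_opC shift_op1; congr (_ + _).
Qed.

Lemma shift_op_compXn M w u n m : shift_op (w \Po 'X^M) u (M * n + m)%N
  = shift_op w (fun a => u (M * a + m)%N) n.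
Proof.
elim/poly_ind: w n => [|w c IH] n; first by rewrite comp_poly0 !shift_op0.
rewrite comp_polyD comp_polyM comp_polyX comp_polyC !shift_opD shift_opX -[c%:P]mulr1 !shift_opC !shift_op1.
congr (_ + _); rewrite -IH mulrC shift_opM.
have -> : forall v k, shift_op 'X^M v k = v (k + M)%N.
  elim: M {IH} => [|M IH] v k; first by rewrite expr0 shift_op1 addn0.
  by rewrite exprSr shift_opX IH addSnnS.
by congr (shift_op _ _ _); lia.
Qed.

Definition ann u w := evt (fun n => shift_op w u n = 0).

Lemma ann_evt0 w u : evt (fun n => u n = 0) -> ann u w.
Proof.
by move=> [N HN]; exists N => n le_n; rewrite /shift_op big1 // => k _; rewrite HN ?mulr0 //; lia.
Qed.

Lemma ann_mul u w p : ann u w -> ann u (p * w).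
Proof. by move/(ann_evt0 p); apply: evt_imp => n; rewrite shift_opM. Qed.

Lemma ann_dvd u w p : w %| p -> ann u w -> ann u p.
Proof. by case/dvdpP=> v ->; exact: ann_mul. Qed.

Lemma annD u1 u2 w : ann u1 w -> ann u2 w -> ann (fun n => u1 n + u2 n) w.
Proof.
apply: evt_imp2 => n e1 e2; rewrite -[RHS]addr0 -{1}e1 -e2 /shift_op -big_split /=.
by apply: eq_bigr => k _; rewrite mulrDr.
Qed.

Lemma annZ u w c : ann u w -> ann (fun n => c * u n) w.
Proof.
apply: evt_imp => n e; rewrite -[RHS](mulr0 c) -e mulr_sumr.
by apply: eq_bigr => k _; rewrite mulrCA.
Qed.

Lemma ann_shift u w k : ann u w -> ann (fun n => u (n + k)%N) w.
Proof.
move/(evt_shift k); apply: evt_imp => n e; rewrite -[RHS]e.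
by apply: eq_bigr => i _; rewrite addnAC.
Qed.

Lemma ann_coprime u w1 w2 : coprimep w1 w2 -> ann u w1 -> ann u w2 ->
  evt (fun n => u n = 0).
Proof.
move=> /Bezout_eq1_coprimepP[[a b] /= e] /(ann_mul a) A1 /(ann_mul b).
by apply: evt_imp2 A1 => n e1 e2; rewrite -[u n]shift_op1 -e shift_opD e1 e2 addr0.
Qed.

(** The generalized kernel of [w], which unlike its kernel is stable under multiplication by
    polynomials in [n]. *)
Definition kerinf w u := exists k, ann u (w ^+ k).

Lemma annXW u w k l : (k <= l)%N -> ann u (w ^+ k) -> ann u (w ^+ l).
Proof. by move=> le_kl; apply: ann_dvd; exact: dvdp_exp2l. Qed.

Lemma kerinfD w u1 u2 : kerinf w u1 -> kerinf w u2 -> kerinf w (fun n => u1 n + u2 n).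
Proof.
move=> [k1 A1] [k2 A2]; exists (k1 + k2)%N.
by apply: annD; [apply: annXW A1|apply: annXW A2]; lia.
Qed.

Lemma kerinf_nat w u : kerinf w u -> kerinf w (fun n => n%:R * u n).
Proof.
move=> [k A]; exists k.+1.
have A1 := annXW (leqnSn k) A.
have A2 : ann u ('X * (w ^+ k.+1)^`()).
  have -> : 'X * (w ^+ k.+1)^`() = ('X * (w^`() *+ k.+1)) * w ^+ k.
    by rewrite deriv_exp /= -mulrnAl mulrA.
  exact: ann_mul.
apply: evt_imp2 A1 A2 => n e1 e2.
pose q := w ^+ k.+1; rewrite -/q in e1 e2 *.
have sz : (size ('X * q^`())%R <= (size q).+1)%N.
  apply: leq_trans (size_polyMleq _ _) _; rewrite size_polyX add2n /= ltnS.
  exact: leq_trans (size_poly _ _) (leq_pred _).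
rewrite (shift_opE _ _ sz) in e2; rewrite (shift_opE _ _ (leqnSn _)) in e1; rewrite (shift_opE _ _ (leqnSn _)).
transitivity (n%:R * (\sum_(i < (size q).+1) q`_i * u (n + i)%N)
    + \sum_(i < (size q).+1) ('X * q^`())`_i * u (n + i)%N); last by rewrite e1 e2 mulr0 addr0.
rewrite mulr_sumr -big_split /=; apply: eq_bigr => i _; rewrite natrD coefXM.
case: (nat_of_ord i) => [|j] /=; first by rewrite !addr0 mul0r addr0 mulrCA.
by rewrite coef_deriv -[q`_j.+1 *+ _]mulr_natr; move: j.+1%:R => x; ring.
Qed.

Lemma kerinfM w u p : kerinf w u -> kerinf w (fun n => p.[n%:R] * u n).
Proof.
move=> K; elim/poly_ind: p => [|p c IH].
  by exists 0%N; exists 0%N => n _; rewrite shift_op1 horner0 mul0r.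
have -> : (fun n => (p * 'X + c%:P).[n%:R] * u n) =
    (fun n => n%:R * (p.[n%:R] * u n) + c * u n).
  by apply/funext => n; rewrite hornerD hornerM hornerX hornerC; ring.
by apply: kerinfD; [exact: kerinf_nat|case: K => k K; exists k; exact: annZ].
Qed.

Lemma kerinf_shift w u k : kerinf w u -> kerinf w (fun n => u (n + k)%N).
Proof. by move=> [l A]; exists l; exact: ann_shift. Qed.

Lemma kerinf_sum w N (u : nat -> nat -> C) :
  (forall k, (k < N)%N -> kerinf w (u k)) -> kerinf w (fun n => \sum_(k < N) u k n).
Proof.
elim: N => [|N IH] H.
  by exists 0%N; exists 0%N => n _; rewrite shift_op1 big_ord0.
have -> : (fun n => \sum_(k < N.+1) u k n) = fun n => \sum_(k < N) u k n + u N n.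
  by apply/funext => n; rewrite big_ord_recr.
by apply: kerinfD; [apply: IH => k ?; apply: H; lia|exact: H].
Qed.

End Operators.

(** * Polynomial antidifferences and unipotent recurrences *)

Section Antidifference.
Variable C : fieldType.
Hypothesis char0 : [pchar C] =i pred0.

(** Induction on the size: the difference of [lead_coef p / k.+1%:R *: 'X^k.+1] has the leading term
    of [p]. *)
Lemma antidifference (p : {poly C}) : exists s, shiftp 1 s - s = p.
Proof.
have [n] := ubnP (size p); elim: n p => // n IH p lt_p.
have [->|nz] := eqVneq p 0; first by exists 0; rewrite raddf0 subrr.
pose k := (size p).-1; have sp : size p = k.+1.
  by rewrite /k prednK // size_poly_gt0.
pose s0 : {poly C} := (lead_coef p / k.+1%:R) *: 'X^(k.+1).
have [|s1 e1] := IH (p - (shiftp 1 s0 - s0)); last first.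
  by exists (s1 + s0); rewrite raddfD opprD addrACA e1 subrK.
suff : (size (p - (shiftp 1 s0 - s0))%R <= k)%N by move: lt_p; rewrite sp; lia.
have [T sT eT] : exists2 T : {poly C}, (size T <= k)%N &
    (('X + 1) ^+ k.+1 = 'X^(k.+1) + ('X^k *+ k.+1 + T))%R.
  exists (\sum_(i < k) 'X^(k.+1 - i.+2) * 1 ^+ i.+2 *+ 'C(k.+1, i.+2)); last first.
    rewrite exprDn big_ord_recl subn0 expr0 mulr1 bin0 mulr1n; congr (_ + _).
    by rewrite big_ord_recl /= /bump /= subSS subn0 expr1n mulr1 bin1.
  apply: leq_trans (size_sum _ _ _) _; apply/bigmax_leqP => i _.
  rewrite expr1n mulr1 -scaler_nat; apply: leq_trans (size_scale_leq _ _) _.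
  by rewrite size_polyXn; have := ltn_ord i; lia.
have -> : shiftp 1 s0 - s0 = lead_coef p *: 'X^k + (lead_coef p / k.+1%:R) *: T.
  have -> : shiftp 1 s0 = (lead_coef p / k.+1%:R) *: ('X + 1) ^+ k.+1.
    by rewrite /shiftp comp_polyZ comp_Xn_poly /affp scale1r.
  rewrite eT !scalerDr /s0 addrAC subrr add0r; congr (_ + _).
  by rewrite -scaler_nat scalerA divfK // (natf_eq0 char0).
apply/leq_sizeP => j le_j; rewrite coefB coefD !coefZ coefXn [T`_j]nth_default ?mulr0 ?addr0.
  have [->|ne] := eqVneq j k; first by rewrite mulr1 /lead_coef -/k subrr.
  by rewrite mulr0 subr0 nth_default // sp ltn_neqAle eq_sym ne.
exact: leq_trans sT le_j.
Qed.
End Antidifference.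

Section Unipotent.
Variable C : fieldType.
Hypothesis char0 : [pchar C] =i pred0.

Lemma shift_op_XsubC (c : C) u n : shift_op ('X - c%:P) u n = u n.+1 - c * u n.
Proof.
have -> : 'X - c%:P = 1 * 'X + (- c)%:P * 1 by rewrite mul1r mulr1 polyCN.
by rewrite shift_opD shift_opX shift_opC !shift_op1 mulNr.
Qed.

Lemma ann_unipotent (u : nat -> C) e : ann u (('X - 1%:P) ^+ e) ->
  exists p : {poly C}, evt (fun n => u n = p.[n%:R]).
Proof.
elim: e u => [|e IH] u A.
  by exists 0; apply: evt_imp A => n; rewrite expr0 shift_op1 horner0.
have [|p [N HN]] := IH (shift_op ('X - 1%:P) u).
  by apply: evt_imp A => n; rewrite exprSr shift_opM.
have [s es] := antidifference char0 p.
exists (s + (u N - s.[N%:R])%:P); exists N => n le_n.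
rewrite -(subnKC le_n); elim: (n - N)%N => [|k IHk].
  by rewrite addn0 hornerD hornerC addrC subrK.
have := HN (N + k)%N (leq_addr _ _); rewrite shift_op_XsubC mul1r -es hornerD hornerN shiftp_nat => e1.
rewrite addnS -[u _](subrK (u (N + k)%N)) e1 IHk !hornerD !hornerC addn1.
by rewrite addrA subrK.
Qed.

End Unipotent.

(** * Characteristic roots of self-similar sequences *)

Section RootsOfUnity.
Variable C : closedFieldType.
Hypothesis char0 : [pchar C] =i pred0.
Variables (G : nat -> C) (M m : nat) (gam : C) (P : {poly C}).
Hypotheses (M_gt1 : (1 < M)%N) (gam_neq0 : gam != 0) (P_neq0 : P != 0).
Hypothesis secG : forall a, G (M * a + m)%N = gam * G a.
Let g n := P.[n%:R] * G n.

(** By minimality [m1] turns [g] into a nonzero eigensequence [h] for [lam]. Self-similarity puts a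
    polynomial multiple of [h] in the generalized kernel of [mM]; were [mM] coprime to
    ['X - lam%:P], this would force [h] to vanish eventually. *)
Lemma root_ann_power (mu mM : {poly C}) (lam : C) :
  (forall w, ann g w -> w != 0 -> (size mu <= size w)%N) ->
  ann g mu -> mu != 0 -> root mu lam -> mu %| mM \Po 'X^M -> root mM lam.
Proof.
move=> min_mu Amu nz_mu /factor_theorem[m1 e1] dvd_mu.
have nz_m1 : m1 != 0 by apply: contraNneq nz_mu => m0; rewrite e1 m0 mul0r.
pose h := shift_op m1 g.
have nh : ~ evt (fun n => h n = 0).
  move=> /min_mu/(_ nz_m1); rewrite e1 size_Mmonic ?monicXsubC // size_XsubC addn2 /=.
  by rewrite ltnn.
have Ah : ann h ('X - lam%:P).
  by apply: evt_imp Amu => n; rewrite e1 mulrC shift_opM.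
pose p := gam *: (P \Po affp C M m).
have nzp : p != 0 by rewrite scaler_eq0 negb_or gam_neq0 affp_neq0 // ltnW.
(* [p * g] is [P (n) * g (M * n + m)], and [mM] kills this section of [g] because [mM \Po 'X^M]
   kills [g]. *)
have Kpg : kerinf mM (fun n => p.[n%:R] * g n).
  have -> : (fun n => p.[n%:R] * g n) = fun n => P.[n%:R] * g (M * n + m)%N.
    by apply/funext => n; rewrite /p hornerZ horner_affp /g secG; ring.
  apply: kerinfM; exists 1%N; rewrite expr1.
  have := evt_affine m (ltnW M_gt1) (ann_dvd dvd_mu Amu).
  by apply: evt_imp => n; rewrite shift_op_compXn.
(* [h] involves [g] at [n + k] for [k < N]; the product [pt] contains each factor [p (n + k)] needed
   there. *)
pose N := size m1; pose pt := \prod_(i < N) shiftp i p.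
have nzpt : pt != 0 by apply/prodf_neq0 => i _; rewrite shiftp_eq0.
have Kh : kerinf mM (fun n => pt.[n%:R] * h n).
  have -> : (fun n => pt.[n%:R] * h n) = fun n => \sum_(k < N)
     (m1`_k *: \prod_(i < N | i != k :> nat) shiftp i p).[n%:R]
        * (p.[(n + k)%:R] * g (n + k)%N).
    apply/funext => n; rewrite /h /shift_op mulr_sumr; apply: eq_bigr => k _.
    rewrite /pt (bigD1 k) //= hornerM hornerZ shiftp_nat; ring.
  apply: (@kerinf_sum _ _ _ (fun k n =>
     (m1`_k *: \prod_(i < N | i != k :> nat) shiftp i p).[n%:R]
        * (p.[(n + k)%:R] * g (n + k)%N))) => k _.
  by apply: kerinfM; exact: kerinf_shift k Kpg.
have [j Aj] : kerinf ('X - lam%:P) (fun n => pt.[n%:R] * h n).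
  by apply: kerinfM; exists 1%N; rewrite expr1.
have [k Ak] := Kh; apply: contrapT => /negP nroot; apply: nh.
have cop : coprimep (('X - lam%:P) ^+ j) (mM ^+ k).
  by apply/coprimep_expl/coprimep_expr; rewrite coprimep_sym coprimep_XsubC.
apply: evt_imp2 (ann_coprime cop Aj Ak) (poly_evt char0 nzpt) => n /eqP.
by rewrite mulf_eq0 => /orP[/eqP->|/eqP//]; rewrite eqxx.
Qed.

(** The [M]-th power permutes the finitely many roots of a minimal annihilator, so they are roots of
    unity. On progressions modulo a common order [R] the recurrence becomes unipotent. *)
Lemma self_similar_quasipoly (w : {poly C}) : w != 0 -> ann g w ->
  exists2 R, (0 < R)%N & forall b, exists p : {poly C},
    evt (fun a => g (R * a + b)%N = p.[a%:R]).
Proof.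
move=> nzw Aw.
have exs : exists s, `[< exists2 v : {poly C}, v != 0 /\ size v = s & ann g v >].
  by exists (size w); apply/asboolP; exists w.
case: (ex_minnP exs) => s /asboolP[mu [nz_mu smu] Amu] mins.
have min_mu v : ann g v -> v != 0 -> (size mu <= size v)%N.
  by move=> Av nzv; rewrite smu; apply: mins; apply/asboolP; exists v.
have [rs ers] := closed_field_poly_normal mu.
have root_rs z : root mu z = (z \in rs).
  by rewrite ers rootZ ?lead_coef_eq0 // root_prod_XsubC.
have dvd_prod (v : C -> {poly C}) : (forall z, z \in rs -> 'X - z%:P %| v z) ->
    mu %| \prod_(z <- rs) v z.
  move=> Hv; rewrite ers dvdpZl ?lead_coef_eq0 //; elim: (rs) Hv => [|z r IH] Hv.
    by rewrite !big_nil.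
  rewrite !big_cons; apply: dvdp_mul; first by apply: Hv; rewrite inE eqxx.
  by apply: IH => y yr; apply: Hv; rewrite inE yr orbT.
(* Take for [mM] the product over the [z ^+ M]: each ['X - z%:P] divides ['X^M - (z ^+ M)%:P]. *)
have pow_rs lam : lam \in rs -> exists2 z, z \in rs & lam = z ^+ M.
  rewrite -root_rs => rl.
  have : root (\prod_(z <- [seq z ^+ M | z <- rs]) ('X - z%:P)) lam.
    apply: root_ann_power rl _ => //.
    rewrite big_map rmorph_prod; apply: dvd_prod => z _ /=.
    by rewrite dvdp_XsubCl comp_polyB comp_polyX comp_polyC rootE !hornerE subrr.
  by rewrite root_prod_XsubC => /mapP[z zr ->]; exists z.
(* A factor ['X] only shifts the index, which eventual annihilation ignores, so minimality excludes
   it. *)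
have rs_neq0 z : z \in rs -> z != 0.
  rewrite -root_rs => rz; apply/eqP => z0; move: rz; rewrite z0.
  move=> /factor_theorem[m1 e1]; rewrite subr0 in e1.
  have nz1 : m1 != 0 by apply: contraNneq nz_mu => m0; rewrite e1 m0 mul0r.
  have A1 : ann g m1.
    apply: (@evt_unshift _ 1); apply: evt_imp Amu => n; rewrite e1 shift_opX => <-.
    by rewrite addn1.
  by have := min_mu _ A1 nz1; rewrite e1 size_mulX // ltnn.
(* Every root is an [M]-th power of a root; counting distinct roots, the powers are exactly the
   roots. *)
have pow_closed z : z \in rs -> z ^+ M \in rs.
  have [_ eq] : (size (undup rs) = size [seq z ^+ M | z <- undup rs]) *
      (undup rs =i [seq z ^+ M | z <- undup rs]).
    apply: uniq_min_size; rewrite ?undup_uniq ?size_map //.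
    move=> y; rewrite mem_undup => /pow_rs[x xr ->].
    by apply: (map_f (fun z => z ^+ M)); rewrite mem_undup.
  move=> zr; rewrite -mem_undup eq; apply: (map_f (fun z => z ^+ M)).
  by rewrite mem_undup.
have unity z : z \in rs -> exists2 R, (0 < R)%N & z ^+ R = 1.
  move=> zr; have itr k : z ^+ (M ^ k) \in rs.
    by elim: k => [|k IH]; rewrite ?expn0 ?expr1 // expnSr exprM pow_closed.
  have : ~~ injectiveb (fun k : 'I_(size rs).+1 => z ^+ (M ^ k)).
    apply/negP => /injectiveP inj.
    have : (size [seq z ^+ (M ^ (k : 'I_(size rs).+1)) | k <- enum 'I_(size rs).+1] <= size rs)%N.
      apply: uniq_leq_size; first by rewrite map_inj_uniq ?enum_uniq.
      by move=> y /mapP[k _ ->].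
    by rewrite size_map size_enum_ord ltnn.
  move/injectivePn => [i [j ne_ij eij]].
  wlog lt_ij : i j ne_ij eij / (i < j)%N.
    move=> hw; case: (ltngtP i j) => [lt|lt|e]; first exact: (hw i j).
      by apply: (hw j i) => //; rewrite eq_sym.
    by case/eqP: ne_ij; apply: val_inj.
  have ltM : (M ^ i < M ^ j)%N by rewrite ltn_exp2l.
  exists (M ^ j - M ^ i)%N; first by rewrite subn_gt0.
  have nz : z ^+ (M ^ i) != 0 by rewrite expf_neq0 // rs_neq0.
  by apply: (mulfI nz); rewrite mulr1 -exprD subnKC // ltnW.
have [R R0 HR] : exists2 R, (0 < R)%N & forall z, z \in rs -> z ^+ R = 1.
  elim: (rs) unity => [|z r IH] H; first by exists 1%N.
  have [|R1 R10 H1] := IH; first by move=> y yr; apply: H; rewrite inE yr orbT.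
  have [|R2 R20 H2] := H z; first by rewrite inE eqxx.
  exists (R1 * R2)%N => [|y]; first by rewrite muln_gt0 R10.
  by rewrite inE => /orP[/eqP->|/H1 e]; [rewrite mulnC|]; rewrite exprM ?e ?H2 expr1n.
exists R => // b; apply: (@ann_unipotent _ char0 _ (size rs)).
have A : ann g ((('X - 1%:P) ^+ size rs) \Po 'X^R).
  apply: ann_dvd Amu; rewrite rmorphXn /= comp_polyB comp_polyX comp_polyC.
  rewrite -iter_mulr_1 -(count_predT rs) -big_const_seq; apply: dvd_prod => z zr.
  by rewrite dvdp_XsubCl rootE !hornerE HR // subrr.
by apply: evt_imp (evt_affine b R0 A) => n; rewrite shift_op_compXn.
Qed.

End RootsOfUnity.

(** * Gaps in recurrences and dilation-invariant rational functions *)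

Section MoreSpan.
Variable C : fieldType.
Hypothesis char0 : [pchar C] =i pred0.

Lemma ratspan_trans s s' (g : 'I_s -> nat -> C) (g' : 'I_s' -> nat -> C) h :
  (forall i, ratspan g' (g i)) -> ratspan g h -> ratspan g' h.
Proof.
move=> gg' [D nzD [t ev]]; apply: (ratspan_div nzD ev).
elim: (index_enum _) => [|i r IH].
  by apply: ratspan_ext (ratspan0 g') => n; rewrite big_nil.
apply: (@ratspan_ext _ _ _ _ (fun n => (t i).[n%:R] * g i n + \sum_(j <- r) (t j).[n%:R] * g j n)).
  by move=> n; rewrite big_cons.
by apply: ratspanD => //; exact: ratspanM.
Qed.

(** A zero window beyond the roots of the leading coefficient propagates forever. *)
Lemma precursive_gap r (h : nat -> C) : precursive r h ->
  (forall N, exists2 n, (N <= n)%N & forall i, (i < r)%N -> h (n + i)%N = 0) ->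
  evt (fun n => h n = 0).
Proof.
move=> /precursive_lead[r' [p [le_r nz ev]]] gap.
have [N HN] := evt_imp2 (fun n => @conj _ _) ev (poly_evt char0 nz).
have [n le_n zn] := gap N.
suff z j : h (n + j)%N = 0 by exists n => k le_k; rewrite -(subnKC le_k).
elim/ltn_ind: j => j IH; case: (ltnP j r) => [/zn//|le_j].
have [e nz'] := HN (n + (j - r'))%N (leq_trans le_n (leq_addr _ _)).
move: e; rewrite big_ord_recr big1 /= ?add0r => [/eqP|i _].
  by rewrite mulf_eq0 (negPf nz') -addnA subnK ?(leq_trans le_r) // => /eqP.
by rewrite -addnA IH ?mulr0 //; have := ltn_ord i; lia.
Qed.

(** [p / q] is an eigenfunction of the dilation by [M]. Orders of vanishing at 0 are split off, and
    then a value and an order at 0 are compared. *)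
Lemma monomial_ratio (p q : {poly C}) (c : C) (M : nat) :
  p != 0 -> q != 0 -> (1 < M)%N ->
  (p \Po (M%:R *: 'X)) * q = c *: (p * (q \Po (M%:R *: 'X))) ->
  exists kap a b, kap != 0 /\ 'X^b * p = kap *: ('X^a * q).
Proof.
move=> nzp nzq M1 e.
have nzM : M%:R != 0 :> C by rewrite natf_eq0 //; lia.
have comp0 (u : {poly C}) : (u \Po (M%:R *: 'X)).[0] = u.[0].
  by rewrite horner_comp !hornerE.
have dilX n : 'X^n \Po (M%:R *: 'X) = M%:R ^+ n *: 'X^n :> {poly C}.
  by rewrite comp_Xn_poly exprZn.
have [a [p2 /implyP/(_ nzp) p20 ep]] := multiplicity_XsubC p 0.
have [b [q2 /implyP/(_ nzq) q20 eq]] := multiplicity_XsubC q 0.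
rewrite subr0 in ep eq; rewrite !rootE in p20 q20.
pose c' := c * M%:R ^+ b / M%:R ^+ a.
have e2 : (p2 \Po (M%:R *: 'X)) * q2 = c' *: (p2 * (q2 \Po (M%:R *: 'X))).
  have nzX : 'X^a * 'X^b != 0 :> {poly C} by rewrite mulf_neq0 // expf_neq0 // polyX_eq0.
  have nzMa : M%:R ^+ a != 0 :> C by rewrite expf_neq0.
  move: e; rewrite ep eq !comp_polyM !dilX.
  move: (p2 \Po _) (q2 \Po _) ('X^a) ('X^b) nzX => pM qM x y nzX.
  rewrite -!mul_polyC => e; have nzMaP : (M%:R ^+ a)%:P != 0 :> {poly C} by rewrite polyC_eq0.
  apply: (mulfI nzX); apply: (mulfI nzMaP).
  transitivity (pM * ((M%:R ^+ a)%:P * x) * (q2 * y)); first by ring.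
  have ec : (M%:R ^+ a)%:P * c'%:P = c%:P * (M%:R ^+ b)%:P.
    by rewrite -!polyCM /c' mulrC divfK.
  rewrite e; transitivity ((c%:P * (M%:R ^+ b)%:P) * (p2 * x * y * qM)); first by ring.
  by rewrite -ec; ring.
have c'1 : c' = 1.
  have := congr1 (horner^~ 0) e2; rewrite /= hornerZ !hornerM !comp0 => /esym/eqP.
  by rewrite -subr_eq0 -{2}[_ * q2.[0]]mul1r -mulrBl mulf_eq0 mulf_eq0 (negPf p20) (negPf q20) !orbF subr_eq0 => /eqP.
pose kap := p2.[0] / q2.[0].
exists kap, a, b; split; first by rewrite mulf_neq0 ?invr_neq0.
suff -> : p = kap *: (q2 * 'X^a) by rewrite eq -!mul_polyC; ring.
rewrite ep; suff -> : p2 = kap *: q2 by rewrite scalerAl.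
(* A nonzero difference would vanish at 0 to some order [j > 0] and satisfy the same equation,
   whence [M ^ j = 1]. *)
apply/eqP; rewrite -subr_eq0; apply: contrapT => /negP nzs.
have [j [s2 /implyP/(_ nzs) s20 es]] := multiplicity_XsubC (p2 - kap *: q2) 0.
rewrite subr0 in es; rewrite rootE in s20.
have es2 : ((p2 - kap *: q2) \Po (M%:R *: 'X)) * q2 = (p2 - kap *: q2) * (q2 \Po (M%:R *: 'X)).
  rewrite comp_polyB comp_polyZ !mulrBl e2 c'1 scale1r -!mul_polyC; congr (_ - _); ring.
have e3 : (M%:R ^+ j *: (s2 \Po (M%:R *: 'X))) * q2 = s2 * (q2 \Po (M%:R *: 'X)).
  have nzX : 'X^j != 0 :> {poly C} by rewrite expf_neq0 // polyX_eq0.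
  move: es2; rewrite es comp_polyM dilX; move: (s2 \Po _) (q2 \Po _) ('X^j) nzX => sM qM x nzX.
  rewrite -!mul_polyC => es2; apply: (mulfI nzX).
  transitivity (s2 * x * qM); last by ring.
  by rewrite -es2; ring.
have /eqP := congr1 (horner^~ 0) e3; rewrite /= !hornerM hornerZ !comp0 -mulrA -subr_eq0.
rewrite -{2}[_ * q2.[0]]mul1r -mulrBl !mulf_eq0 (negPf s20) (negPf q20) !orbF subr_eq0.
rewrite -natrX => /eqP e1'; have e1 : (M ^ j = 1)%N by apply: (natf_inj char0).
case: j es e1 {e1' e3} => [|j] es e1; last first.
  by have := ltn_expl j.+1 M1; rewrite e1.
have := congr1 (horner^~ 0) es; rewrite expr0 mulr1 /= => /esym s0.
by move/eqP: s20; apply; rewrite s0 hornerD hornerN hornerZ divfK // subrr.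
Qed.

End MoreSpan.

(** * Multiplicative P-recursive sequences *)

Section Multiplicative.
Variable C : fieldType.
Hypothesis char0 : [pchar C] =i pred0.
Variables (f : nat -> C) (r : nat).
Hypothesis f_mul : multiplicative_fun f.
Hypothesis f_rec : precursive r f.
Hypothesis f_nz : ~ evt (fun n => f n = 0).

Lemma mul_fun1 : f 1 = 1.
Proof.
have e : f 1 = f 1 * f 1 by rewrite -f_mul.
have [z|nz] := eqVneq (f 1) 0; last by apply: (mulfI nz); rewrite mulr1 -e.
case: f_nz; exists 1%N => n n0; rewrite -[n]mul1n f_mul //; first by rewrite z mul0r.
by rewrite /coprime gcd1n.
Qed.

(** Otherwise a zero window is lengthened one term at a time: a congruence modulo a new prime power
    makes a vanishing [l ^ k] an exact divisor of the next term. *)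
Lemma zero_prime_powers_finite :
  exists B, forall l k, prime l -> (B < l)%N -> f (l ^ k)%N != 0.
Proof.
apply: contrapT => noB.
have inf B : exists l k, [/\ prime l, (B < l)%N & f (l ^ k)%N = 0].
  apply: contrapT => H; apply: noB; exists B => l k pl lB; apply/eqP => z.
  by apply: H; exists l, k.
have win s : exists Q a, (0 < Q)%N /\ forall n, n = a %[mod Q] ->
    forall i, (i < s)%N -> f (n + i)%N = 0.
  elim: s => [|s [Q [a [Q0 H]]]]; first by exists 1%N, 0%N.
  have [l [k [pl lQ z]]] := inf Q.
  have l0 := prime_gt0 pl; pose L := (l ^ k.+1)%N.
  have cop : coprime Q L.
    by rewrite coprimeXr // coprime_sym prime_coprime // gtnNdvd.
  have L0 : (0 < L)%N by rewrite expn_gt0 l0.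
  (* This is [l ^ k - s] modulo [L], written without a truncated subtraction. *)
  pose b := (l ^ k + s * (L - 1))%N.
  exists (Q * L)%N, (chinese Q L a b); rewrite muln_gt0 Q0 L0; split=> // n e i.
  have e1 : n = a %[mod Q].
    by rewrite -(chinese_modl cop a b); have := congr1 (modn^~ Q) e; rewrite !modn_dvdm ?dvdn_mulr.
  have e2 : n = b %[mod L].
    by rewrite -(chinese_modr cop a b); have := congr1 (modn^~ L) e; rewrite !modn_dvdm ?dvdn_mull.
  rewrite ltnS leq_eqVlt => /orP[/eqP->|]; last exact: H e1 i.
  have e3 : (n + s = l ^ k %[mod L])%N.
    rewrite -modnDml e2 modnDml /b -addnA (_ : s * (L - 1) + s = s * L)%N; last by rewrite -{2}(muln1 s) -mulnDr subnK.
    by rewrite addnC modnMDl.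
  have lt_k : (l ^ k < L)%N by rewrite ltn_exp2l // prime_gt1.
  have -> : (n + s = l ^ k * (((n + s) %/ L) * l + 1))%N.
    by rewrite {1}(divn_eq (n + s) L) e3 modn_small // /L expnS mulnDr muln1 [(l * _)%N]mulnC mulnCA.
  rewrite f_mul ?z ?mul0r ?expn_gt0 ?l0 ?addn1 //.
  by apply: coprimeXl; rewrite prime_coprime // -addn1 dvdn_addr ?dvdn_mull // dvdn1; have := prime_gt1 pl; lia.
case: f_nz; apply: (precursive_gap char0 f_rec) => N; have [Q [a [Q0 H]]] := win r.
by exists (a + N * Q)%N; [nia|apply: H; rewrite addnC modnMDl].
Qed.

(** The defect [h] is supported on multiples of [l] and has a recurrence of order at most [2r < l].
    At a multiple of [l] all other terms of the recurrence vanish, so [h] is eventually zero. *)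
Lemma prime_section (B l : nat) : (forall l k, prime l -> (B < l)%N -> f (l ^ k)%N != 0) ->
  prime l -> (r + r < l)%N -> (B < l)%N ->
  forall n, (0 < n)%N -> f (l * n)%N = f l * f n.
Proof.
move=> HB pl lr lB; pose h n := f (l * n)%N - f l * f n.
have h0 n : (0 < n)%N -> ~~ (l %| n)%N -> h n = 0.
  move=> n0 ln; rewrite /h (f_mul (prime_gt0 pl) n0) ?subrr //.
  by rewrite prime_coprime.
have [r' [p [le_r nz ev]]] := precursive_lead f_rec.
have sp := precursive_ratspan char0 nz ev; have l0 := prime_gt0 pl.
pose g (i : 'I_(r' + r')) n := match split i with
  inl j => f (l * n + 0 + j)%N | inr j => f (n + j)%N end.
have spg j : ratspan g (fun n => f (n + j)%N).
  apply: ratspan_trans (sp j) => i.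
  apply: (ratspan_ext _ (ratspan_gen g (rshift r' i))) => n.
  by rewrite /g; case: split_ordP => k /eqP; rewrite ?eq_rlshift // eq_rshift => /eqP->.
have spl j : ratspan g (fun n => f (l * n + 0 + j)%N).
  apply: ratspan_trans (ratspan_affine char0 0 l0 (sp j)) => i.
  apply: (ratspan_ext _ (ratspan_gen g (lshift r' i))) => n.
  by rewrite /g; case: split_ordP => k /eqP; rewrite ?eq_lrshift // eq_lshift => /eqP->.
have ph : precursive (r' + r') h.
  apply: (@ratspan_dep C _ g (fun k n => h (n + k)%N)) => k _.
  apply: (@ratspan_ext _ _ _ _ (fun n => f (l * n + 0 + l * k)%N + (- (f l)%:P).[n%:R] * f (n + k)%N)).
    by move=> n; rewrite /h hornerN hornerC mulNr; congr (f _ - _); lia.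
  by apply: ratspanD => //; exact: ratspanM.
have [r2 [p2 [le_r2 nz2 ev2]]] := precursive_lead ph.
have [N HN] : evt (fun n => h n = 0).
  have [N HN] := evt_imp2 (fun n => @conj _ _) ev2 (poly_evt char0 nz2).
  exists (N + r2 + 1)%N => n le_n; case: (boolP (l %| n)%N) => [ln|]; last by apply: h0; lia.
  have [|e nzp] := HN (n - r2)%N; first by lia.
  move: e; rewrite big_ord_recr big1 /= ?add0r => [/eqP|i _].
    by rewrite mulf_eq0 (negPf nzp) subnK => [/eqP//|]; lia.
  rewrite h0 ?mulr0 //; first by lia.
  have := ltn_ord i => lt_i; apply/negP => li.
  have := dvdn_sub ln li; rewrite (_ : n - (n - r2 + i) = r2 - i)%N; last by lia.
  by move/dvdn_leq; lia.
(* To reach small [n], multiply by a large prime [u] with [f u != 0] and cancel [f u]. *)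
move=> n n0; have [u lt_u pu] := prime_above (maxn (maxn B N) (l * n)).
rewrite !gtn_max in lt_u; case/andP: lt_u => /andP[uB uN] uln.
have nzu : f u != 0 by have := HB u 1%N pu uB; rewrite expn1.
have cu m : (0 < m)%N -> (m <= l * n)%N -> coprime m u.
  by move=> m0 le_m; rewrite coprime_sym prime_coprime // gtnNdvd //; lia.
have ln0 : (0 < l * n)%N by rewrite muln_gt0 l0.
have e1 : f (l * (n * u))%N = f (l * n)%N * f u by rewrite mulnA (f_mul ln0 (prime_gt0 pu) (cu _ ln0 (leqnn _))).
have e2 : f (n * u)%N = f n * f u by rewrite (f_mul n0 (prime_gt0 pu)) // cu // leq_pmull.
have le_N : (N <= n * u)%N by apply: leq_trans (ltnW uN) (leq_pmull _ n0).
have /eqP := HN _ le_N; rewrite /h e1 e2 mulrA -mulrBl mulf_eq0 (negPf nzu) orbF subr_eq0.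
by move/eqP.
Qed.

(** With [Q] a factorial, prime factors of integers prime to [Q] exceed the bounds required above;
    they are split off one by one. *)
Lemma completely_multiplicative_away : exists2 Q, (0 < Q)%N &
  forall a, (0 < a)%N -> coprime a Q ->
    f a != 0 /\ forall m, (0 < m)%N -> f (a * m)%N = f a * f m.
Proof.
have [B HB] := zero_prime_powers_finite.
pose B' := maxn B (r + r); exists (B'`!)%N; first exact: fact_gt0.
have big l : prime l -> ~~ (l %| B'`!)%N -> (B' < l)%N.
  move=> pl; apply: contraR; rewrite -leqNgt => le_l.
  by apply: dvdn_fact; rewrite prime_gt0.
elim/ltn_ind => a IH a0 ca; case: (ltnP 1 a) => [a1|le_a]; last first.
  have -> : a = 1%N by lia.
  by rewrite mul_fun1 oner_eq0; split=> // m m0; rewrite mul1n mul1r.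
have pl := pdiv_prime a1; set l := pdiv a in pl.
have ea : a = (l * (a %/ l))%N by rewrite mulnC divnK // pdiv_dvd.
have a'0 : (0 < a %/ l)%N by rewrite divn_gt0 ?prime_gt0 // pdiv_leq.
move: ca; rewrite {1}ea coprimeMl => /andP[cl ca'].
have lB : (B' < l)%N by apply: big => //; rewrite -prime_coprime.
have [] := IH (a %/ l)%N _ a'0 ca'; first by rewrite ltn_Pdiv // prime_gt1.
move=> nz' H'; rewrite gtn_max in lB; case/andP: lB => lB lr.
have sec := prime_section HB pl lr lB.
have fa : f a = f l * f (a %/ l)%N by rewrite {1}ea sec.
rewrite fa; split.
  by rewrite mulf_neq0 //; have := HB l 1%N pl lB; rewrite expn1.
by move=> m m0; rewrite {1}ea -mulnA sec ?muln_gt0 ?a'0 // H' // mulrA.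
Qed.

End Multiplicative.

(** * The power law on a progression *)

Section PowerLaw.
Variable C : closedFieldType.
Hypothesis char0 : [pchar C] =i pred0.
Variables (f : nat -> C) (r Q : nat).
Hypothesis f_rec : precursive r f.
Hypothesis Q_gt0 : (0 < Q)%N.
Hypothesis f_cmul : forall a, (0 < a)%N -> coprime a Q ->
    f a != 0 /\ forall m, (0 < m)%N -> f (a * m)%N = f a * f m.

Lemma coprime_1mod (R t : nat) : (Q %| R)%N -> coprime (R * t + 1) Q.
Proof.
by case/dvdnP=> k ->; rewrite addn1 mulnAC coprime_sym /coprime -addn1 gcdnMDl gcdn1.
Qed.

Lemma power_law : exists Q' a b, [/\ (0 < Q')%N, (Q %| Q')%N &
  forall t, let N := (Q' * t + 1)%N in N%:R ^+ b * f N = N%:R ^+ a].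
Proof.
pose G t := f (Q * t + 1)%N.
have cop t : coprime (Q * t + 1) Q by apply: coprime_1mod.
have nzG t : G t != 0 by apply: (f_cmul _ (cop t)).1; rewrite addn1.
have mulG (R t u : nat) : (Q %| R)%N -> f ((R * t + 1) * (R * u + 1))%N = f (R * t + 1)%N * f (R * u + 1)%N.
  by move=> dR; apply: (f_cmul _ (coprime_1mod t dR)).2; rewrite addn1.
(* Since [(Q + 1) * (Q * a + 1) = Q * ((Q + 1) * a + 1) + 1]. *)
have secG a : G (Q.+1 * a + 1)%N = G 1%N * G a.
  by rewrite /G -mulG //; congr f; lia.
have nG : ~ evt (fun n => G n = 0).
  by move=> [N /(_ N (leqnn N))/eqP]; apply/negP.
have [|P nzP [w nzw evw]] := self_similar_precursive char0
  (precursive_section char0 1 Q_gt0 f_rec) nG _ (nzG 1%N) secG; first by lia.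
have [|R R0 HR] := self_similar_quasipoly char0 _ (nzG 1%N) nzP secG nzw evw; first by lia.
have [p evp] := HR 0%N.
pose Q' := (Q * R)%N; have Q'0 : (0 < Q')%N by rewrite muln_gt0 Q_gt0.
have QQ' : (Q %| Q')%N by exact: dvdn_mulr.
(* [ph] and [Ph] are the numerator and denominator of [f] in the variable [N = Q' * t + 1], in which
   multiplication by [M] is a pure dilation. *)
pose ph := p \Po iaffp C Q' 1; pose Ph := (P \Po affp C R 0) \Po iaffp C Q' 1.
have iaff (u : {poly C}) t : (u \Po iaffp C Q' 1).[(Q' * t + 1)%:R] = u.[t%:R].
  by rewrite -horner_affp comp_iaffpK.
have evN : evt (fun t => Ph.[(Q' * t + 1)%:R] * f (Q' * t + 1)%N = ph.[(Q' * t + 1)%:R]).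
  apply: evt_imp evp => t e; rewrite /Ph /ph !iaff horner_affp -e; congr (_ * f _).
  by rewrite /Q' addn0 mulnA.
have nzPh : Ph != 0.
  by rewrite -(affp_neq0 char0 _ 1 Q'0) comp_iaffpK // affp_neq0.
have nzPa : Ph \Po affp C Q' 1 != 0 by rewrite affp_neq0.
have nzf t : f (Q' * t + 1)%N != 0.
  by apply: (f_cmul _ (coprime_1mod t QQ')).1; rewrite addn1.
have nzph : ph != 0.
  apply/eqP => p0; have [N HN] := evt_imp2 (fun t => @conj _ _) evN
    (poly_evt char0 nzPa).
  have [e] := HN N (leqnn N); rewrite horner_affp => nz; move/eqP: e.
  by rewrite p0 horner0 mulf_eq0 (negPf nz) (negPf (nzf N)).
pose M := (Q' * 1 + 1)%N.
have dil (u : {poly C}) n : (u \Po (M%:R *: 'X)).[n%:R] = u.[(M * n)%:R].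
  by rewrite horner_comp hornerZ hornerX natrM.
have evM : evt (fun t => Ph.[(M * (Q' * t + 1))%:R] * f (M * (Q' * t + 1))%N
    = ph.[(M * (Q' * t + 1))%:R]).
  apply: evt_imp (evt_affine 1 (ltn0Sn Q') evN) => t.
  by have -> : (Q' * (Q'.+1 * t + 1) + 1 = M * (Q' * t + 1))%N by rewrite /M; lia.
have eM : (ph \Po (M%:R *: 'X)) * Ph = f M *: (ph * (Ph \Po (M%:R *: 'X))).
  apply/eqP; rewrite -subr_eq0; apply/eqP.
  set D := (X in X = 0); suff : D \Po affp C Q' 1 = 0.
    by move/eqP; apply: contraTeq => nz; rewrite affp_neq0.
  apply: (poly_evt0 char0); apply: evt_imp2 evN evM => t e1 e2.
  rewrite horner_affp /D hornerD hornerN hornerZ !hornerM !dil -e1 -e2 mulG //.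
  by rewrite -/M; ring.
have M1 : (1 < M)%N by rewrite /M; lia.
have [kap [a [b [nzk ekap]]]] := monomial_ratio char0 nzph nzPh M1 eM.
exists Q', a, b; split=> // t N.
have [N0 HN0] := evt_imp2 (fun t => @conj _ _) evN (poly_evt char0 nzPa).
have large s : (N0 <= s)%N -> (Q' * s + 1)%:R ^+ b * f (Q' * s + 1)%N
    = kap * (Q' * s + 1)%:R ^+ a.
  move=> /HN0[e]; rewrite horner_affp => nz; apply: (mulfI nz).
  have := congr1 (horner^~ (Q' * s + 1)%:R) ekap.
  rewrite /= hornerZ !hornerM !hornerXn -e => e'.
  by rewrite mulrCA e'; ring.
(* The law so far holds for large arguments and up to [kap]. Comparing it at [K] and at [K * N],
   with [K] large, removes both restrictions. *)
pose s0 := N0; pose K := (Q' * s0 + 1)%N.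
have eK := large s0 (leqnn _).
have eKN : (K * N)%:R ^+ b * (f K * f N) = kap * (K * N)%:R ^+ a.
  rewrite -mulG // -/K -/N.
  have -> : (K * N = Q' * (s0 + t * (Q' * s0 + 1)) + 1)%N by rewrite /K /N; lia.
  by apply: large; lia.
have nzKa : kap * K%:R ^+ a != 0.
  by rewrite mulf_neq0 // expf_neq0 // natf_eq0 // /K addn1.
apply: (mulfI nzKa); rewrite -{1}eK.
transitivity ((K * N)%:R ^+ b * (f K * f N)); first by rewrite natrM exprMn -/K; ring.
by rewrite eKN natrM exprMn mulrA.
Qed.

End PowerLaw.

(** * Periodicity of the twisted function *)

Section Periodicity.
Variable C : fieldType.
Hypothesis char0 : [pchar C] =i pred0.
Variables (f : nat -> C) (r Q Q' a b : nat).
Hypothesis f_mul : multiplicative_fun f.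
Hypothesis f_rec : precursive r f.
Hypothesis f_cmul : forall a, (0 < a)%N -> coprime a Q ->
    f a != 0 /\ forall m, (0 < m)%N -> f (a * m)%N = f a * f m.
Hypotheses (Q'_gt0 : (0 < Q')%N) (Q_dvd : (Q %| Q')%N).
Hypothesis f_law : forall t, let N := (Q' * t + 1)%N in N%:R ^+ b * f N = N%:R ^+ a.

Let nz (n : nat) : (0 < n)%N -> n%:R != 0 :> C.
Proof. by move=> n0; rewrite natf_eq0 // -lt0n. Qed.

Definition twist (n : nat) : C := f n * n%:R ^+ b / n%:R ^+ a.
Notation g := twist.

Lemma twistM m n : f (m * n)%N = f m * f n -> g (m * n)%N = g m * g n.
Proof. by move=> e; rewrite /g e natrM !exprMn invfM; ring. Qed.

Lemma twist_mul : multiplicative_fun g.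
Proof. by move=> m n m0 n0 cmn; apply: twistM; exact: f_mul. Qed.

Lemma twist_cmul m n : (0 < m)%N -> (0 < n)%N -> coprime m Q -> g (m * n)%N = g m * g n.
Proof. by move=> m0 n0 cm; apply: twistM; apply: (f_cmul m0 cm).2. Qed.

Lemma twist_1mod t : g (Q' * t + 1)%N = 1.
Proof.
rewrite /g [f _ * _]mulrC f_law divff // expf_neq0 // nz //.
by rewrite addn1.
Qed.

Lemma mod1P n : (0 < n)%N -> n = 1 %[mod Q'] -> exists t, n = (Q' * t + 1)%N.
Proof.
move=> n0 e; case: (ltnP 1 Q') => [Q1|le_Q].
  by exists (n %/ Q')%N; rewrite {1}(divn_eq n Q') e (modn_small Q1) mulnC.
by exists n.-1; have -> : Q' = 1%N; lia.
Qed.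

(** By Euler, [w] inverts [v] modulo [Q']; multiplying by it moves both arguments into the class of
    1, where [g] is 1. *)
Lemma twist_unit v v' : (0 < v)%N -> (0 < v')%N -> coprime v Q' -> v = v' %[mod Q'] -> g v = g v'.
Proof.
move=> v0 v'0 cv e; pose w := (v ^ (totient Q').-1)%N.
have w0 : (0 < w)%N by rewrite expn_gt0 v0.
have cw : coprime w Q by apply: coprime_dvdr Q_dvd _; exact: coprimeXl.
have wv : (w * v = 1 %[mod Q'])%N.
  by rewrite /w -expnSr prednK ?totient_gt0 // Euler_exp_totient.
have e1 u : (0 < u)%N -> u = v %[mod Q'] -> g w * g u = 1.
  move=> u0 eu; rewrite -twist_cmul //.
  have [||t ->] := @mod1P (w * u); last exact: twist_1mod.
    by rewrite muln_gt0 w0.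
  by rewrite -modnMmr eu modnMmr.
have nzw : g w != 0 by apply: contra_eq_neq (e1 v v0 (erefl _)) => ->; rewrite mul0r eq_sym oner_neq0.
by apply: (mulfI nzw); rewrite !e1.
Qed.

(** The bound on valuations makes [m] absorb the whole part of [n] built from primes dividing [Q'].
    The shift then preserves [m] and changes the cofactor by a multiple of [Q']. *)
Lemma twist_shift c n : (0 < n)%N ->
  (forall q, prime q -> (q %| Q')%N -> ~~ (q ^ c.+1 %| n)%N) ->
  g (n + Q' ^ c.+1)%N = g n.
Proof.
move=> n0 Hn; pose m := gcdn n (Q' ^ c).
have m0 : (0 < m)%N by rewrite gcdn_gt0 n0.
have mn : (m %| n)%N by exact: dvdn_gcdl.
pose v := (n %/ m)%N; have env : n = (m * v)%N by rewrite mulnC divnK.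
have v0 : (0 < v)%N by rewrite divn_gt0 // dvdn_leq.
have cv : coprime v Q'.
  apply: contrapT => /negP ncv; have d1 : (1 < gcdn v Q')%N.
    by rewrite ltn_neqAle eq_sym ncv gcdn_gt0 v0.
  have pq := pdiv_prime d1; set q := pdiv _ in pq.
  have := pdiv_dvd (gcdn v Q'); rewrite -/q dvdn_gcd => /andP[qv qQ].
  have := Hn q pq qQ; rewrite pfactor_dvdn //.
  have lm : logn q m = minn (logn q n) (c * logn q Q').
    by rewrite /m logn_gcd ?expn_gt0 ?Q'_gt0 // lognX.
  have lv : (0 < logn q v)%N by rewrite -pfactor_dvdn.
  have lQ : (0 < logn q Q')%N by rewrite -pfactor_dvdn.
  have ln : logn q n = (logn q m + logn q v)%N by rewrite env lognM.
  have := leq_pmulr c lQ; rewrite -ltnNge ltnS => le1 le2.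
  by move: ln; rewrite lm (minn_idPl (leq_trans le2 le1)); lia.
have [k ek] : exists k, (Q' ^ c = k * m)%N by apply/dvdnP; exact: dvdn_gcdr.
pose v' := (Q' * k + v)%N.
have env' : (n + Q' ^ c.+1 = m * v')%N by rewrite /v' expnS ek {1}env; lia.
have v'0 : (0 < v')%N by rewrite addn_gt0 v0 orbT.
have evv' : v = v' %[mod Q'] by rewrite /v' mulnC modnMDl.
have cv' : coprime v' Q' by rewrite coprime_sym /coprime /v' mulnC gcdnMDl -/(coprime _ _) coprime_sym.
have cm u : (0 < u)%N -> coprime u Q' -> g (m * u)%N = g m * g u.
  move=> u0 cu; rewrite mulnC twist_cmul //; first by rewrite mulrC.
  exact: coprime_dvdr Q_dvd cu.
by rewrite env' {1}env !cm // (twist_unit v0 v'0).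
Qed.

Lemma twist_periodic : periodic_fun g.
Proof.
have [r' [p [le_r nzp ev]]] := precursive_lead f_rec.
have sp := precursive_ratspan char0 nzp ev.
have spg j : ratspan (fun (i : 'I_r') n => f (n + i)%N) (fun n => g (n + j)%N).
  apply: (@ratspan_div _ _ _ ('X^a \Po affp C 1 j) _
    (fun n => ('X^b \Po affp C 1 j).[n%:R] * f (n + j)%N)).
  - by rewrite affp_neq0 // expf_neq0 // polyX_eq0.
  - exists 1%N => n n0; rewrite !horner_affp !hornerXn mul1n /g mulrC divfK; first by rewrite mulrC.
    by rewrite expf_neq0 // nz //; lia.
  exact: ratspanM.
(* [c] is the total length of [Q'.+1] blocks of length [r'], and [c < q ^ c.+1] for every prime
   [q]. *)
pose c := ((Q'.+1 * r'))%N; pose R := (Q' ^ c.+1)%N.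
have R0 : (0 < R)%N by rewrite expn_gt0 Q'_gt0.
pose h n := g (n + R)%N - g n.
have ph : precursive r' h.
  apply: (@ratspan_dep C _ (fun (i : 'I_r') n => f (n + i)%N) (fun k n => h (n + k)%N)) => k _.
  apply: (@ratspan_ext _ _ _ _ (fun n => g (n + (k + R))%N + (-1%:P).[n%:R] * g (n + k)%N)).
    by move=> n; rewrite /h hornerN hornerC mulN1r addnA.
  by apply: ratspanD => //; exact: ratspanM.
have [N HN] : evt (fun n => h n = 0).
  apply: (precursive_gap char0 ph) => N; apply: contrapT => no.
  (* If every block meets the support of [h], two of them contain multiples of the same [q ^ c.+1],
     which are too close. The prime [q] is stored as an ordinal plus one. *)
  have /choice[x Hx] (k : 'I_Q'.+1) : exists xq : nat * 'I_Q',
      [/\ (N.+1 + k * r' <= xq.1 < N.+1 + k.+1 * r')%N, prime xq.2.+1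
        & (xq.2.+1 ^ c.+1 %| xq.1)%N].
    apply: contrapT => nok; apply: no; exists (N.+1 + k * r')%N; first by lia.
    move=> i lt_i; apply/eqP; rewrite subr_eq0; apply/eqP; apply: twist_shift; first by lia.
    move=> q pq qQ; apply/negP => dq; apply: nok.
    have q0 := prime_gt0 pq.
    have lt_q : (q.-1 < Q')%N by rewrite prednK // dvdn_leq.
    by exists ((N.+1 + k * r' + i)%N, Ordinal lt_q); split=> /=; rewrite ?prednK //; lia.
  have : ~~ injectiveb (fun k : 'I_Q'.+1 => (x k).2).
    by apply/negP => /injectiveP/leq_card; rewrite !card_ord ltnn.
  move/injectivePn => [i [j ne_ij eij]].
  wlog lt_ij : i j ne_ij eij / (i < j)%N.
    move=> hw; case: (ltngtP i j) => [lt|lt|e]; first exact: (hw i j).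
      by apply: (hw j i) => //; rewrite eq_sym.
    by case/eqP: ne_ij; apply: val_inj.
  have [/andP[i1 i2] pi di] := Hx i; have [/andP[j1 j2] pj dj] := Hx j.
  rewrite -eij in dj; set q := (x i).2.+1 in pi di dj.
  have le1 : (i.+1 * r' <= j * r')%N by rewrite leq_mul2r lt_ij orbT.
  have le2 : (j.+1 * r' <= c)%N by rewrite leq_mul2r ltn_ord orbT.
  have lt_c : (c < q ^ c.+1)%N.
    by apply: leq_trans (ltn_expl c (prime_gt1 pi)) _; rewrite leq_exp2l // prime_gt1.
  have := dvdn_sub dj di; move/dvdn_leq; lia.
have perk k n : (N <= n)%N -> g (n + k * R)%N = g n.
  move=> le_n; elim: k => [|k IH]; first by rewrite mul0n addn0.
  have /eqP := HN (n + k * R)%N (leq_trans le_n (leq_addr _ _)).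
  by rewrite subr_eq0 IH -addnA -mulSnr => /eqP.
(* Multiplication by [u], which is 1 modulo [Q'], preserves [g] and moves small arguments beyond
   [N]. *)
exists R => // n n0; pose u := (Q' * N + 1)%N.
have cu : coprime u Q by apply: coprime_1mod.
have u0 : (0 < u)%N by rewrite /u addn1.
have gu k : (0 < k)%N -> g (u * k)%N = g k by move=> k0; rewrite twist_cmul // twist_1mod mul1r.
by rewrite -gu ?addn_gt0 ?n0 // -[RHS]gu // mulnDr perk //; rewrite /u; nia.
Qed.

End Periodicity.

(** * Algebraic power series *)

Section Algebraic.
Variable K : fieldType.
Hypothesis char0 : [pchar K] =i pred0.
Implicit Types (a F y : fps K) (P : {poly {poly K}}) (c : {poly K}).
Notation phi := (@fps_of_poly K).

Definition eval_series F P : fps K := (map_poly phi P).[F].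

Definition polyalg F := exists2 P, P != 0 & eval_series F P = 0.

Lemma eval_seriesD F P1 P2 : eval_series F (P1 + P2) = eval_series F P1 + eval_series F P2.
Proof. by rewrite /eval_series rmorphD hornerD. Qed.
Lemma eval_seriesN F P : eval_series F (- P) = - eval_series F P.
Proof. by rewrite /eval_series rmorphN hornerN. Qed.
Lemma eval_seriesM F P1 P2 : eval_series F (P1 * P2) = eval_series F P1 * eval_series F P2.
Proof. by rewrite /eval_series rmorphM hornerM. Qed.
Lemma eval_seriesC F c : eval_series F c%:P = phi c.
Proof. by rewrite /eval_series map_polyC hornerC. Qed.
Lemma eval_seriesZ F c P : eval_series F (c *: P) = phi c * eval_series F P.
Proof. by rewrite -mul_polyC eval_seriesM eval_seriesC. Qed.
Lemma eval_seriesX F : eval_series F 'X = F.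
Proof. by rewrite /eval_series map_polyX hornerX. Qed.
Lemma eval_series0 F : eval_series F 0 = 0.
Proof. by rewrite /eval_series rmorph0 horner0. Qed.
Lemma eval_series_sum F (I : Type) (r : seq I) (G : I -> {poly {poly K}}) :
  eval_series F (\sum_(i <- r) G i) = \sum_(i <- r) eval_series F (G i).
Proof. by rewrite /eval_series rmorph_sum horner_sum. Qed.

Lemma phi_eq0 c : (phi c == 0) = (c == 0).
Proof. by rewrite -(inj_eq (@fps_of_poly_inj K)) rmorph0. Qed.

Lemma fps_algebraicP F : fps_algebraic F -> polyalg F.
Proof.
move=> [p nzp rp]; pose s := size p.
pose D := \prod_(i < s) \d_(repr p`_i).
pose P : {poly {poly K}} :=
  \poly_(i < s) (\n_(repr p`_i) * \prod_(j < s | j != i :> nat) \d_(repr p`_j)).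
have nzd (i : nat) : \d_(repr p`_i) != 0 by exact: denom_ratioP.
have nzD : D != 0 by apply/prodf_neq0.
have eP : map_poly (@FracField.tofrac {poly K}) P = FracField.tofrac D *: p.
  apply/polyP => i; rewrite coef_map coefZ coef_poly; case: ltnP => lt_i; last first.
    by rewrite [p`_i]nth_default // mulr0 /= tofrac0.
  have -> : D = \d_(repr p`_i) * \prod_(j < s | j != i :> nat) \d_(repr p`_j).
    by rewrite /D (bigD1 (Ordinal lt_i)).
  rewrite /= [X in _ = _ * X](ratfunE p`_i) !tofracM.
  move: (\prod_(j < s | _) _) (nzd i) => z; rewrite -(tofrac_eq0 _) => nzy.
  by rewrite [RHS]mulrC -[RHS]mulrA mulKf.
exists P.
  apply: contraNneq nzp => P0; move/eqP: eP; rewrite P0 rmorph0 eq_sym scaler_eq0.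
  by rewrite tofrac_eq0 (negPf nzD).
apply/eqP; rewrite -tofrac_eq0; apply/eqP.
have -> : FracField.tofrac (eval_series F P)
    = (map_poly (@laurent_of_ratfun K) (map_poly (@FracField.tofrac {poly K}) P)).[FracField.tofrac F].
  rewrite /eval_series -horner_map /= -!map_poly_comp; congr (_.[_]).
  by apply: eq_map_poly => c /=; rewrite laurent_of_ratfun_tofrac.
by rewrite eP map_polyZ hornerZ (eqP rp) mulr0.
Qed.

(** The Euler derivation z d/dz, which acts diagonally on coefficients. *)
Definition theta a : fps K := Fps (fun n => n%:R * fcoef a n).

Lemma thetaD a b : theta (a + b) = theta a + theta b.
Proof. by apply: fpsP => n /=; rewrite mulrDr. Qed.

Lemma theta1 : theta 1 = 0.
Proof. by apply: fpsP => -[|n] /=; rewrite ?mul0r ?mulr0. Qed.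

Lemma thetaM a b : theta (a * b) = theta a * b + a * theta b.
Proof.
apply: fpsP => n /=; rewrite mulr_sumr -big_split /=; apply: eq_bigr => j _.
have -> : n%:R = j%:R + (n - j)%:R :> K.
  by rewrite -natrD subnKC // -ltnS.
by ring.
Qed.

Definition theta_poly c : {poly K} := 'X * c^`().

Lemma theta_phi c : theta (phi c) = phi (theta_poly c).
Proof.
apply: fpsP => -[|n] /=; rewrite coefXM /= ?mul0r // coef_deriv.
by rewrite -[in RHS]mulr_natl.
Qed.

Lemma theta_poly0 : theta_poly 0 = 0.
Proof. by rewrite /theta_poly deriv0 mulr0. Qed.

Definition theta_coef P : {poly {poly K}} := \poly_(i < size P) theta_poly P`_i.

Lemma coef_theta_coef P i : (theta_coef P)`_i = theta_poly P`_i.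
Proof. by rewrite coef_poly; case: ltnP => // le_i; rewrite nth_default // theta_poly0. Qed.

Lemma theta_eval_series F P : theta (eval_series F P) = eval_series F (theta_coef P) + eval_series F P^`() * theta F.
Proof.
elim/poly_ind: P => [|P c IH].
  have -> : theta_coef 0 = 0 by apply/polyP => i; rewrite coef_theta_coef !coef0 theta_poly0.
  by rewrite deriv0 !eval_series0 mul0r addr0; apply: fpsP => n /=; rewrite mulr0.
have -> : theta_coef (P * 'X + c%:P) = theta_coef P * 'X + (theta_poly c)%:P.
  apply/polyP => i; rewrite coef_theta_coef !coefD !coefMX !coefC coef_theta_coef.
  by case: i => [|i] /=; rewrite ?add0r ?addr0.
rewrite derivD derivM derivX derivC mulr1 addr0 !eval_seriesD !eval_seriesM !eval_seriesX !eval_seriesC.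
by rewrite thetaD thetaM IH theta_phi; ring.
Qed.

Lemma polyalg_min F : polyalg F -> exists P m, [/\ size P = m.+2, eval_series F P = 0 &
  forall P', eval_series F P' = 0 -> (size P' <= m.+1)%N -> P' = 0].
Proof.
move=> [P0 nz0 e0].
have ex : exists s, `[< exists2 P : {poly {poly K}}, size P = s /\ P != 0 & eval_series F P = 0 >].
  by exists (size P0); apply/asboolP; exists P0.
case: (ex_minnP ex) => s /asboolP[P [sP nzP] eP] mins.
have s2 : (1 < s)%N.
  rewrite ltnNge -sP; apply/negP => /size1_polyC eC.
  move/eqP: eP; rewrite eC eval_seriesC phi_eq0 => /eqP z; case/eqP: nzP.
  by rewrite eC z polyC0.
exists P, s.-2; rewrite sP; split=> //; first by lia.
move=> P' e' s'; apply/eqP; apply: contrapT => /negP nz'.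
have : (s <= size P')%N by apply: mins; apply/asboolP; exists P'.
by lia.
Qed.

Section Rank.
Variables (F : fps K) (P : {poly {poly K}}) (m : nat).
Hypotheses (sP : size P = m.+2) (eP : eval_series F P = 0).
Hypothesis minP : forall P', eval_series F P' = 0 -> (size P' <= m.+1)%N -> P' = 0.

Definition inR y := exists g, y = eval_series F g.

Lemma inRM y1 y2 : inR y1 -> inR y2 -> inR (y1 * y2).
Proof. by move=> [g1 ->] [g2 ->]; exists (g1 * g2); rewrite eval_seriesM. Qed.
Lemma inRB y1 y2 : inR y1 -> inR y2 -> inR (y1 - y2).
Proof. by move=> [g1 ->] [g2 ->]; exists (g1 - g2); rewrite eval_seriesD eval_seriesN. Qed.
Lemma inRX y k : inR y -> inR (y ^+ k).
Proof.
move=> Ry; elim: k => [|k IH]; last by rewrite exprS; exact: inRM.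
by exists 1; rewrite expr0 /eval_series rmorph1 hornerC.
Qed.
Lemma inRn y k : inR y -> inR (k%:R * y).
Proof. by move=> [g ->]; exists (k%:R * g); rewrite eval_seriesM /eval_series rmorph_nat hornerMn hornerC. Qed.

(** Pseudo-division by [P] reduces elements of [K[z][F]] to degree at most [m] in [F], so its rank
    over [K[z]] is at most [m.+1]. *)
Lemma inR_dep (y : nat -> fps K) : (forall k, (k <= m.+1)%N -> inR (y k)) ->
  exists2 c : nat -> {poly K}, exists2 k, (k <= m.+1)%N & c k != 0 &
    \sum_(k < m.+2) phi (c k) * y k = 0.
Proof.
move=> Ry; have /choice[g Hg] (k : 'I_m.+2) : exists g, y k = eval_series F g.
  by apply: Ry; rewrite -ltnS.
have nzP : P != 0 by rewrite -size_poly_gt0 sP.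
pose rm k := Pdiv.Ring.rmodp (g k) P.
pose lc k := lead_coef P ^+ Pdiv.Ring.rscalp (g k) P.
have erm k : phi (lc k) * y k = eval_series F (rm k).
  rewrite Hg -eval_seriesZ /lc Pdiv.ComRing.rdivp_eq eval_seriesD eval_seriesM eP mulr0 add0r //.
have srm k : (size (rm k) <= m.+1)%N by rewrite -ltnS -sP Pdiv.Ring.ltn_rmodp.
have [v nzv vA] := kernel_row (\matrix_(k < m.+2, i < m.+1) (rm k)`_i).
exists (fun k => v 0 (inord k) * lc (inord k)).
  have /rV0Pn[k nzk] := nzv; exists k; first by rewrite -ltnS.
  by rewrite inord_val mulf_neq0 // expf_neq0 // lead_coef_eq0.
transitivity (eval_series F (\sum_k v 0 k *: rm k)).
  rewrite eval_series_sum; apply: eq_bigr => k _.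
  by rewrite inord_val rmorphM -mulrA erm eval_seriesZ.
suff -> : \sum_k v 0 k *: rm k = 0 by rewrite eval_series0.
apply/polyP => i; rewrite coef_sum coef0; case: (ltnP i m.+1) => [lt_i|le_i]; last first.
  by rewrite big1 // => k _; rewrite coefZ nth_default ?mulr0 // (leq_trans (srm k)).
have := congr1 (fun u : 'rV_ _ => u 0 (Ordinal lt_i)) vA; rewrite /= mxE [RHS]mxE => e.
by rewrite -[RHS]e; apply: eq_bigr => k _; rewrite coefZ mxE.
Qed.

Notation w := (eval_series F P^`()).

Lemma deriv_ev_neq0 : w != 0.
Proof.
apply/eqP => e; have := minP e; rewrite -ltnS -sP => /(_ (lt_size_deriv _)).
have nzP : P != 0 by rewrite -size_poly_gt0 sP.
move=> /(_ nzP) d0; have := congr1 (fun p : {poly {poly K}} => p`_m) d0.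
rewrite coef_deriv coef0 -mulr_natr => /eqP; rewrite mulf_eq0 => /orP[/eqP z|].
  have : lead_coef P = 0 by rewrite lead_coefE sP.
  by move/eqP; rewrite lead_coef_eq0 (negPf nzP).
by rewrite -polyC_natr polyC_eq0 natf_eq0.
Qed.

Lemma inRF : inR F.
Proof. by exists 'X; rewrite eval_seriesX. Qed.
Lemma inRw : inR w.
Proof. by exists P^`(). Qed.

(** Differentiating [P(F) = 0] shows that [w], the value of the derivative of [P] at [F], is a
    denominator for [theta F]. *)
Lemma inR_w_theta : inR (w * theta F).
Proof.
have := theta_eval_series F P; rewrite eP => e; exists (- theta_coef P).
rewrite eval_seriesN; apply/eqP; rewrite -addr_eq0 addrC -e; apply/eqP.
by apply: fpsP => n /=; rewrite mulr0.
Qed.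

Lemma inR_theta y : inR y -> inR (w * theta y).
Proof.
move=> [g ->]; rewrite theta_eval_series mulrDr mulrCA.
have [h ->] := inR_w_theta.
by exists (P^`() * theta_coef g + g^`() * h); rewrite eval_seriesD !eval_seriesM.
Qed.

(** Each derivation costs two factors [w]: one for [theta] itself, one for differentiating the power
    of [w] already present. *)
Lemma inR_iter k : inR (w ^+ (2 * k) * iter k theta F).
Proof.
elim: k => [|k IH] /=; first by rewrite muln0 expr0 mul1r; exact: inRF.
have Rt := inRM inRw (inR_theta IH).
have Rw := inRM (inRn (2 * k) (inR_theta inRw)) IH.
have thw j : w * theta (w ^+ j) = j%:R * (w ^+ j * theta w).
  elim: j => [|j IHj]; first by rewrite expr0 theta1 mulr0 mul0r.
  by rewrite exprS thetaM mulrDr IHj -natr1; ring.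
suff -> : w ^+ (2 * k.+1) * theta (iter k theta F)
    = w * (w * theta (w ^+ (2 * k) * iter k theta F))
      - ((2 * k)%:R * (w * theta w)) * (w ^+ (2 * k) * iter k theta F) by exact: inRB.
rewrite thetaM [w * (_ + _)]mulrDr [w * (theta _ * _)]mulrA thw mulnS exprD expr2.
move: (2 * k)%:R (w ^+ (2 * k)) => x y; ring.
Qed.

End Rank.
End Algebraic.

(** * Recurrences and transcendence from algebraicity *)

Section AlgebraicConsequences.
Variable K : fieldType.
Hypothesis char0 : [pchar K] =i pred0.
Implicit Types (a F y : fps K) (P : {poly {poly K}}) (c : {poly K}).
Notation phi := (@fps_of_poly K).

Lemma fcoef_sum (I : Type) (r : seq I) (G : I -> fps K) n :
  fcoef (\sum_(i <- r) G i) n = \sum_(i <- r) fcoef (G i) n.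
Proof. by elim: r => [|i r IH]; rewrite ?big_nil // !big_cons /= IH. Qed.

Lemma fcoefB a b n : fcoef (a - b) n = fcoef a n - fcoef b n.
Proof. by []. Qed.

Lemma fcoef_theta a n : fcoef (theta a) n = n%:R * fcoef a n.
Proof. by []. Qed.

Lemma iter_thetaE k F n : fcoef (iter k (@theta K) F) n = n%:R ^+ k * fcoef F n.
Proof. by elim: k => [|k IH] /=; rewrite ?expr0 ?mul1r // IH exprS mulrA. Qed.

(** The first [m.+2] powers of [theta F], cleared by one power of [w], lie in a module of rank at
    most [m.+1]. *)
Lemma polyalg_theta F : polyalg F -> polyalg (theta F).
Proof.
move=> /polyalg_min[P [m [sP eP minP]]].
pose w := eval_series F P^`(); have nzw : w != 0 := deriv_ev_neq0 char0 sP minP.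
have Rw : inR F w := inRw F P.
have Rt : inR F (w * theta F) := inR_w_theta eP.
have [k le_k|c [k le_k nzk] e] := inR_dep sP eP (y := fun k => w ^+ m.+1 * theta F ^+ k).
  have -> : w ^+ m.+1 * theta F ^+ k = w ^+ (m.+1 - k) * (w * theta F) ^+ k.
    by rewrite exprMn mulrA -exprD subnK.
  by apply: inRM; apply: inRX.
exists (\poly_(k < m.+2) c k).
  apply/eqP => /(congr1 (fun p : {poly {poly K}} => p`_k)); rewrite coef_poly coef0 ltnS le_k.
  by move/eqP: nzk.
have nzw' : w ^+ m.+1 != 0 by rewrite expf_neq0.
apply: (mulfI nzw'); rewrite mulr0 -[RHS]e poly_def eval_series_sum mulr_sumr.
apply: eq_bigr => i _; rewrite eval_seriesZ /eval_series map_polyXn hornerXn; ring.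
Qed.

Lemma polyalg_iter_theta k F : polyalg F -> polyalg (iter k (@theta K) F).
Proof. by move=> aF; elim: k => //= k; exact: polyalg_theta. Qed.

(** The same rank count applied to iterates of [theta] gives a linear differential equation for [F];
    its coefficients yield the recurrence. *)
Lemma polyalg_precursive (f : nat -> K) : polyalg (gen_fps f) -> exists r, precursive r f.
Proof.
set F := gen_fps f => /polyalg_min[P [m [sP eP minP]]].
pose w := eval_series F P^`(); have nzw : w != 0 := deriv_ev_neq0 char0 sP minP.
have [k le_k|c [k0 le_k nzk] e] := inR_dep sP eP
    (y := fun k => w ^+ (2 * m.+1) * iter k (@theta K) F).
  have -> : w ^+ (2 * m.+1) * iter k (@theta K) F
      = w ^+ (2 * (m.+1 - k)) * (w ^+ (2 * k) * iter k (@theta K) F).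
    by rewrite mulrA -exprD -mulnDr subnK.
  by apply: inRM; [apply: inRX; exact: inRw | exact: inR_iter].
have {}e : \sum_(k < m.+2) phi (c k) * iter k (@theta K) F = 0.
  have nzw' : w ^+ (2 * m.+1) != 0 by rewrite expf_neq0.
  apply: (mulfI nzw'); rewrite mulr0 -[RHS]e mulr_sumr.
  by apply: eq_bigr => i _; rewrite mulrCA.
pose J := \max_(k < m.+2) size (c k).
have sJ (k : 'I_m.+2) : (size (c k) <= J)%N by exact: (leq_bigmax (F := fun k : 'I_m.+2 => size (c k))).
(* In the coefficient of degree [n + J], the term [f (n + i)] meets the coefficient of degree
   [J - i] of [c k], with the factor [(n + i)%:R ^+ k]. *)
exists J, (fun i => (\poly_(k < m.+2) (c k)`_(J - i)) \Po affp K 1 i).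
  pose j := (size (c k0)).-1.
  have le_j : (j <= J)%N.
    apply: leq_trans (leq_pred _) (sJ (Ordinal (_ : (k0 < m.+2)%N))).
    by rewrite ltnS.
  exists (J - j)%N; first by rewrite leq_subr.
  rewrite affp_neq0 //; apply/eqP => /(congr1 (fun p : {poly K} => p`_k0)).
  rewrite coef_poly coef0 ltnS le_k subKn // => /eqP.
  by rewrite -lead_coefE lead_coef_eq0 (negPf nzk).
(* Index 0 is avoided: there [gen_fps f] has coefficient 0, whatever [f 0] is. *)
exists 1%N => n n0.
have := congr1 (fun a => fcoef a (n + J)%N) e; rewrite /= fcoef_sum => e'.
transitivity (\sum_(k < m.+2) \sum_(i < J.+1) (c k)`_(J - i) * ((n + i)%:R ^+ k * f (n + i)%N)).
  rewrite exchange_big; apply: eq_bigr => i _ /=.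
  rewrite horner_affp mul1n horner_poly mulr_suml.
  by apply: eq_bigr => k _; rewrite mulrA.
rewrite -[RHS]e'; apply: eq_bigr => k _ /=.
rewrite (reindex_inj rev_ord_inj) /=.
rewrite (big_ord_widen (n + J).+1 (fun i => (c k)`_(J - (J.+1 - i.+1)) *
  ((n + (J.+1 - i.+1))%:R ^+ k * f (n + (J.+1 - i.+1))%N))) ?ltnS ?leq_addl //.
rewrite big_mkcond; apply: eq_bigr => i _; rewrite ltnS.
case: leqP => [le_i|lt_i]; last by rewrite [(c k)`_i]nth_default ?mul0r // (leq_trans (sJ k)) // ltnW.
rewrite subSS subKn // iter_thetaE /= (_ : (n + J - i = n + (J - i))%N); last by lia.
by rewrite (_ : (n + (J - i) == 0)%N = false) //; lia.
Qed.

(** Subtract the multiple of [v] that cancels the coefficient of [s] at the order [i] of [v]. If the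
    remainder has an order [j], comparing coefficients of degree [j + i] forces [j = i], a
    contradiction. *)
Lemma theta_wronskian (s v : fps K) : v != 0 -> theta s * v = s * theta v ->
  exists k : K, s = phi k%:P * v.
Proof.
move=> nzv e; have [i nzi lti] := fps_neq0_order nzv.
pose k := fcoef s i / fcoef v i; exists k; apply/eqP; rewrite -subr_eq0.
apply: contrapT => /negP; set t := s - _ => nzt.
have phk a n : fcoef (phi k%:P * a) n = k * fcoef a n.
  rewrite /= big_ord_recl /= coefC subn0 big1 ?addr0 // => j _.
  by rewrite coefC mul0r.
have et : theta t * v = t * theta v.
  have -> : theta t = theta s - phi k%:P * theta v.
    apply: fpsP => n; rewrite fcoefB fcoef_theta fcoefB !phk !fcoef_theta; ring.
  by rewrite /t mulrBl e; ring.
have [j nzj ltj] := fps_neq0_order nzt.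
have ti : fcoef t i = 0.
  by rewrite fcoefB phk divfK // subrr.
have low (a b : fps K) : (forall l, (l < j)%N -> fcoef a l = 0) ->
    (forall l, (l < i)%N -> fcoef b l = 0) -> fcoef (a * b) (j + i)%N = fcoef a j * fcoef b i.
  move=> la lb; have lt_j : (j < (j + i).+1)%N by rewrite ltnS leq_addr.
  rewrite /= (bigD1 (Ordinal lt_j)) //= addKn big1 ?addr0 // => l ne_l.
  case: (ltngtP l j) => [/la->|lt_l|e_l]; first by rewrite mul0r.
    by rewrite lb ?mulr0 //; have := ltn_ord l; lia.
  by case/eqP: ne_l; apply: val_inj.
have : fcoef (theta t * v) (j + i) = fcoef (t * theta v) (j + i) by rewrite et.
have tj l : (l < j)%N -> fcoef (theta t) l = 0 by move=> lt; rewrite fcoef_theta ltj ?mulr0.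
have vi l : (l < i)%N -> fcoef (theta v) l = 0 by move=> lt; rewrite fcoef_theta lti ?mulr0.
rewrite !low // !fcoef_theta => /eqP.
rewrite -subr_eq0 (_ : _ - _ = (j%:R - i%:R) * (fcoef t j * fcoef v i)); last by ring.
rewrite !mulf_eq0 (negPf nzj) (negPf nzi) !orbF subr_eq0 => /eqP/(natf_inj char0) eji.
by move: nzj; rewrite eji ti eqxx.
Qed.

(** Differentiating the minimal equation and cancelling its top term leaves a relation of smaller
    degree, hence zero. Its next coefficient says that [m.+1%:R * y + cl / cm] has zero
    derivative. *)
Lemma rational_theta_rational y (A B : {poly K}) : polyalg y -> B != 0 ->
  phi B * theta y = phi A -> exists2 v : {poly K}, v != 0 & exists u, phi v * y = phi u.
Proof.
move=> /polyalg_min[P [m [sP eP minP]]] nzB eB.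
pose cm := P`_m.+1; pose cl := P`_m.
have nzcm : cm != 0.
  have : lead_coef P != 0 by rewrite lead_coef_eq0 -size_poly_gt0 sP.
  by rewrite lead_coefE sP.
pose S := cm *: (B *: theta_coef P + A *: P^`()) - (B * theta_poly cm) *: P.
have S0 : S = 0.
  apply: minP.
    have := theta_eval_series y P; rewrite eP => et.
    have z : eval_series y (theta_coef P) + eval_series y P^`() * theta y = 0.
      by rewrite -et; apply: fpsP => n /=; rewrite mulr0.
    rewrite /S eval_seriesD eval_seriesN !eval_seriesZ eval_seriesD !eval_seriesZ eP mulr0 subr0 -eB.
    by rewrite (_ : _ + _ = phi B * (eval_series y (theta_coef P) + eval_series y P^`() * theta y)); [rewrite z !mulr0|ring].
  apply/leq_sizeP => j le_j; rewrite /S coefB !coefZ coefD !coefZ coef_theta_coef coef_deriv.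
  have zj : P`_j.+1 = 0 by rewrite nth_default // sP.
  rewrite zj mul0rn mulr0 addr0; case: (ltngtP j m.+1) => [|lt_j|->]; first by lia.
    by rewrite [P`_j]nth_default ?sP // theta_poly0 !mulr0 subrr.
  by rewrite -/cm; ring.
have := congr1 (fun p : {poly {poly K}} => p`_m) S0.
rewrite /S coefB !coefZ coefD !coefZ coef_theta_coef coef_deriv coef0 -/cm -/cl => ec.
pose v := phi cm; pose s := phi cl + phi m.+1%:R * v * y.
have nzv : v != 0 by rewrite phi_eq0.
have [|k ek] := @theta_wronskian s v nzv.
  apply/eqP; rewrite -subr_eq0; apply/eqP.
  have nzphiB : phi B != 0 by rewrite phi_eq0.
  apply: (mulfI nzphiB); rewrite mulr0.
  have ec' : v * (phi B * theta (phi cl) + phi B * theta y * (v * phi m.+1%:R))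
      - phi B * theta v * phi cl = 0.
    rewrite eB !theta_phi; move: (theta_poly cl) (theta_poly cm) ec => t1 t2 /(congr1 phi).
    by rewrite -[cm *+ _]mulr_natr rmorph0 rmorphB !rmorphM rmorphD !rmorphM.
  rewrite -[RHS]ec' /s !thetaD !thetaM.
  have -> : theta (phi m.+1%:R) = 0.
    by rewrite -polyC_natr theta_phi /theta_poly derivC mulr0 rmorph0.
  move: (phi m.+1%:R) => e1; ring.
exists (m.+1%:R * cm).
  by rewrite mulf_neq0 // -polyC_natr polyC_eq0 natf_eq0.
exists (k%:P * cm - cl); by rewrite rmorphB !rmorphM -ek /s addrAC subrr add0r.
Qed.

(** Here [theta y] is rational with denominator [1 - 'X^R], so an algebraic [y] would be rational.
    Its coefficients would then satisfy a constant-coefficient recurrence, which the distinct poles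
    of the fractions [1 / (n - j)] forbid. *)
Lemma periodic_over_n_transcendental (chi : nat -> K) (y : fps K) (R : nat) : (0 < R)%N ->
  (forall n, (0 < n)%N -> chi (n + R)%N = chi n) -> chi 1%N != 0 ->
  (forall n, (0 < n)%N -> n%:R * fcoef y n = chi n) -> ~ polyalg y.
Proof.
move=> R0 per chi1 ey ay.
have cXn a n : fcoef (phi 'X^R * a) n = if (n < R)%N then 0 else fcoef a (n - R)%N.
  case: ltnP => [lt_n|le_n] /=.
    by rewrite big1 // => j _; rewrite coefXn (_ : (j == R :> nat) = false) ?mul0r //; have := ltn_ord j; lia.
  have lt_R : (R < n.+1)%N by [].
  rewrite (bigD1 (Ordinal lt_R)) //= coefXn eqxx mul1r big1 ?addr0 // => j ne_j.
  by rewrite coefXn (_ : (j == R :> nat) = false) ?mul0r //; apply/negbTE; rewrite -val_eqE in ne_j.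
pose A := \poly_(n < R.+1) fcoef (theta y) n.
have nzB : 1 - 'X^R != 0 :> {poly K}.
  apply/eqP => /(congr1 (fun p : {poly K} => p`_0)); rewrite coefB coef1 coefXn coef0.
  by rewrite (ltn_eqF R0) subr0 => /eqP; rewrite oner_eq0.
have [|v nzv [u eu]] := @rational_theta_rational y A _ ay nzB.
  apply: fpsP => n; rewrite rmorphB rmorph1 mulrBl mul1r.
  rewrite -[fcoef (_ - _) n]/(fcoef (theta y) n - fcoef (phi 'X^R * theta y) n) cXn.
  rewrite [RHS]/= coef_poly ltnS; case: (ltngtP n R) => [lt|lt|->].
  - by rewrite subr0.
  - by rewrite /= !ey ?subn_gt0 ?(ltn_trans R0) // -(per (n - R)%N) ?subn_gt0 // subnK ?subrr // ltnW.
  - by rewrite subnn /= mul0r subr0.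
pose j0 := (size v).-1; pose T := (size v + size u)%N.
have sv : size v = j0.+1 by rewrite /j0 prednK // size_poly_gt0.
have vj0 : v`_j0 != 0 by rewrite -lead_coefE lead_coef_eq0.
have perk k n : (0 < n)%N -> chi (n + R * k)%N = chi n.
  move=> n0; elim: k => [|k IH]; first by rewrite muln0 addn0.
  by rewrite mulnS addnCA addnC per ?IH // addn_gt0 n0.
(* For [n = R * t + j0.+1] the value [chi (n - j)] is independent of [t], and it is [chi 1] for
   [j = j0]. [S] is the numerator of the sum of the [wt j / (x - j)]. *)
pose wt j := v`_j * chi (j0.+1 - j + R * T)%N.
pose S : {poly K} := \sum_(j < j0.+1) (wt j)%:P * \prod_(i < j0.+1 | i != j) ('X - i%:R%:P).
have S0 : S = 0.
  have : S \Po affp K R j0.+1 = 0.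
    apply: (poly_evt0 char0); exists T => t le_t; rewrite horner_affp.
    set n := (R * t + j0.+1)%N.
    have le_n : (T <= n)%N by rewrite /n; nia.
    have pos (j : 'I_j0.+1) : (0 < n - j)%N by have := ltn_ord j; rewrite /n; lia.
    have := congr1 (fun a => fcoef a n) eu; rewrite /= [u`_n]nth_default; last by exact: leq_trans (leq_addl _ _) le_n.
    rewrite -(big_mkord xpredT (fun j => v`_j * fcoef y (n - j)%N)).
    rewrite (@big_cat_nat _ _ _ j0.+1) //=; last by rewrite /n; lia.
    rewrite [X in _ + X]big_nat_cond [X in _ + X]big1 ?addr0 => [|j /andP[/andP[lj _] _]]; last first.
      by rewrite nth_default ?mul0r // sv.
    rewrite big_mkord => e0.
    transitivity ((\prod_(i < j0.+1) (n%:R - i%:R)) * \sum_(j < j0.+1) v`_j * fcoef y (n - j)%N);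
      last by rewrite e0 mulr0.
    rewrite horner_sum mulr_sumr.
    apply: eq_bigr => j _; rewrite hornerM hornerC horner_prod [X in _ = X * _](bigD1 j) //=.
    have -> : wt j = v`_j * ((n%:R - j%:R) * fcoef y (n - j)%N).
      rewrite /wt -natrB; last by have := pos j; lia.
      rewrite ey //; congr (_ * _).
      have ej : (j < j0.+1)%N := ltn_ord j.
      have -> : (n - j = j0.+1 - j + R * t)%N by rewrite /n; lia.
      by rewrite !perk // subn_gt0.
    rewrite (eq_bigr (fun i : 'I__ => n%:R - i%:R)) => [|i _]; last by rewrite hornerXsubC.
    by move: (\prod_(i < _ | _) _) => z; ring.
  by move/eqP; apply: contraTeq => nz; rewrite affp_neq0.
have := congr1 (horner^~ j0%:R) S0; rewrite /= horner0 horner_sum (bigD1 ord_max) //=.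
rewrite [X in _ + X]big1 ?addr0 => [/eqP|j ne_j]; last first.
  rewrite hornerM horner_prod (bigD1 ord_max) /=; last by rewrite eq_sym.
  by rewrite hornerXsubC subrr mul0r mulr0.
rewrite hornerM hornerC mulf_eq0 /wt subSnn perk // mulf_eq0 (negPf vj0) (negPf chi1) /=.
rewrite horner_prod prodf_seq_eq0 => /hasP[i _ /andP[ne_i]].
rewrite hornerXsubC subr_eq0 => /eqP/(natf_inj char0) e.
by case/eqP: ne_i; apply: val_inj.
Qed.

End AlgebraicConsequences.

(** * The theorem *)

(** Coordinates over the rationals make [K] countable, and a countable field has an algebraic
    closure. *)
Lemma numfield_closure (K : fieldExtType rat) :
  exists C : closedFieldType, exists iota : {rmorphism K -> C}, True.
Proof.
pose cK := CanIsCountable (@VectorInternalTheory.v2rK rat K).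
pose K' : countFieldType := HB.pack_for countFieldType (K : Type) (GRing.Field.on K) cK.
have [C [iota _]] := countable_algebraic_closure K'.
by exists C, iota.
Qed.

Lemma precursive_map (K C : fieldType) (iota : {rmorphism K -> C}) r (f : nat -> K) :
  precursive r f -> precursive r (fun n => iota (f n)).
Proof.
move=> [p [i le_i nz] ev]; exists (fun i => map_poly iota (p i)).
  by exists i; rewrite // map_poly_eq0.
apply: evt_imp ev => n e; rewrite -[RHS](rmorph0 iota) -e rmorph_sum.
by apply: eq_bigr => k _; rewrite rmorphM -(rmorph_nat iota) horner_map.
Qed.

Theorem precursive_multiplicative (C : closedFieldType) (char0 : [pchar C] =i pred0)
    (f : nat -> C) (r : nat) :
  multiplicative_fun f -> precursive r f -> ~ eventually_zero f ->
  exists a b, periodic_fun (twist f a b) /\ multiplicative_fun (twist f a b).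
Proof.
move=> f_mul f_rec f_nz.
have [Q Q0 f_cmul] := completely_multiplicative_away char0 f_mul f_rec f_nz.
have [Q' [a [b [Q'0 QQ' law]]]] := power_law char0 f_rec Q0 f_cmul.
exists a, b; split; last exact: twist_mul.
exact: (@twist_periodic C char0 f r Q Q' a b f_rec f_cmul Q'0 QQ' law).
Qed.

Theorem theorem4p1 (K : fieldExtType rat) (f : nat -> K)
  (f_mul : multiplicative_fun f)
  (F_alg : fps_algebraic (gen_fps f)) :
  eventually_zero f \/
  exists (k : nat) (chi : nat -> K),
    [/\ periodic_fun chi,
        multiplicative_fun chi &
        forall n : nat, (0 < n)%N -> f n = n%:R ^+ k * chi n].
Proof.
case: (pselect (eventually_zero f)) => [|f_nz]; [by left|right].
have charK : [pchar K] =i pred0.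
  by move=> p; rewrite pchar_lalg Num.Theory.pchar_num.
have F_palg := fps_algebraicP F_alg.
have [r f_rec] := polyalg_precursive charK F_palg.
have [C [iota _]] := numfield_closure K.
have charC : [pchar C] =i pred0 by move=> p; rewrite (fmorph_pchar iota) charK.
have [|||a [b [[d d0 per] _]]] := precursive_multiplicative charC (f := fun n => iota (f n)) (r := r).
- by move=> m n m0 n0 c; rewrite f_mul // rmorphM.
- exact: precursive_map.
- by move=> [N HN]; apply: f_nz; exists N => n /HN/eqP; rewrite fmorph_eq0 => /eqP.
pose g := twist f a b.
(* The twist is already defined over [K], so injectivity of [iota] brings its periodicity back. *)
have iotag n : iota (g n) = twist (fun n => iota (f n)) a b n.
  by rewrite /g /twist fmorph_div rmorphM !rmorphXn !rmorph_nat.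
have g_per n : (0 < n)%N -> g (n + d)%N = g n.
  by move=> n0; apply: (fmorph_inj iota); rewrite !iotag per.
have g_mul : multiplicative_fun g by exact: twist_mul.
have nz n : (0 < n)%N -> n%:R != 0 :> K by move=> n0; rewrite natf_eq0 // -lt0n.
case: (leqP b a) => [le_ba|lt_ab].
  exists (a - b)%N, g; split=> //; first by exists d.
  move=> n n0; have nb : n%:R ^+ b != 0 :> K by rewrite expf_neq0 ?nz.
  have na : n%:R ^+ a != 0 :> K by rewrite expf_neq0 ?nz.
  by apply: (mulIf nb); rewrite mulrAC -exprD subnK // /g /twist [RHS]mulrC divfK.
(* For [a < b], the series with [b - a - 1] applications of [theta] has coefficients [g n / n], yet
   remains algebraic. *)
case: (@periodic_over_n_transcendental K charK g (iter (b - a).-1 (@theta K) (gen_fps f)) d) => //.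
- by rewrite /g /twist !expr1n mulr1 divr1 (mul_fun1 f_mul) ?oner_eq0.
- move=> n n0; have na : n%:R ^+ a != 0 :> K by rewrite expf_neq0 ?nz.
  rewrite iter_thetaE mulrA -exprS prednK ?subn_gt0 // /= (gtn_eqF n0) /g /twist.
  by apply: (mulIf na); rewrite divfK // mulrAC -exprD subnK 1?mulrC // ltnW.
- exact: polyalg_iter_theta.
Qed.
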